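(* Let $K$ be a field, $R=K[x_1,\dots,x_n]$ a standard graded polynomial ring, and let $I_1,\dots,I_m$ be non-zero homogeneous ideals of $R$. For each $i=1,\dots,m$ let $f_{i1},\dots,f_{ig_i}$ be a minimal homogeneous generating system of $I_i$ and set $d_{ij}=\deg f_{ij}$. For $a=(a_1,\dots,a_m)\in\mathbb{N}^m$ write $I^a=I_1^{a_1}\cdots I_m^{a_m}$. Then for every $0\le j\le n-1$ there exist $b_j\in\mathbb{N}$ and linear functions $$L^{(j)}_k(u)=\sum_{i=1}^m\lambda^{(j)}_{ki}u_i+\lambda^{(j)}_{k0},\qquad 1\le k\le b_j,$$ with $\lambda^{(j)}_{ki}\in\{d_{i1},\dots,d_{ig_i}\}$ for $i=1,\dots,m$ and $\lambda^{(j)}_{k0}\in\mathbb{Z}$, such that $$t_j^R(I^a)=\sup\{L^{(j)}_k(a): 1\le k\le b_j\}\quad\text{for } a\gg 0.$$ In particular, $\operatorname{pd}_R(I^a)$ is constant for $a\gg 0$, and $$\operatorname{reg}(I^a)=\sup\{L^{(j)}_k(a)-j: 0\le j\le n-1 \text{ and } 1\le k\le b_j\}\quad\text{for } a\gg 0.$$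
   Context: $\mathbb{N}$ contains $0$. A ''linear function'' may have a constant term. The supremum of the empty set is $-\infty$ (so $b_j=0$ is allowed). A formula or property is said to hold for $a\gg 0$ if there exists $b\in\mathbb{N}^m$ such that it holds for every $a\in b+\mathbb{N}^m$. For a finitely generated graded non-zero $R$-module $M$ and an integer $0\le j\le\operatorname{pd}_R(M)$ (projective dimension), $t_j^R(M)$ denotes the largest degree of a minimal generator of the $j$-th syzygy module of $M$ (in the minimal graded free resolution; the $0$-th syzygy module is $M$ itself); by convention $t_j^R(M)=-\infty$ if $j>\operatorname{pd}_R(M)$. The Castelnuovo-Mumford regularity is $\operatorname{reg}(M)=\operatorname{reg}_R(M)=\max\{t_j^R(M)-j: j\ge 0\}$. *)

(* Defs.v *)
From Stdlib Require Import ClassicalEpsilon.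
From mathcomp Require Import all_boot all_order all_algebra.
(* The notations of [constructive_ereal] clash with those of [mpoly]: \bar int
   is written [extended int], -oo is [ENInf], and z%:E is [EFin z]. *)
From mathcomp Require Export -(notations) constructive_ereal.
From mathcomp Require Export mpoly.

Set Implicit Arguments.
Unset Strict Implicit.
Unset Printing Implicit Defensive.

Import Order.TTheory GRing.Theory Num.Theory.
Local Open Scope ring_scope.

Section Modules.

Variables (R : comNzRingType) (V : lmodType R).
Implicit Types N : V -> Prop.

Definition generates N (r : nat) (g : 'I_r -> V) :=
  forall v, N v <-> exists c : 'I_r -> R, v = \sum_k c k *: g k.

Definition irredundant (r : nat) (g : 'I_r -> V) :=
  forall k, ~ exists c : 'I_r -> R, g k = \sum_(l | l != k) c l *: g l.

(* [hom e v] means that v is homogeneous of degree e; an irredundant system does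
   not contain 0, so the degrees d are determined by g. *)
Definition minimal_hom_gens (hom : nat -> V -> Prop) N (r : nat)
    (d : 'I_r -> nat) (g : 'I_r -> V) :=
  [/\ generates N g, irredundant g & forall k, hom (d k) (g k)].

Definition projective (P : lmodType R) :=
  forall (A B : lmodType R) (g : {linear A -> B}) (f : {linear P -> B}),
    (forall y, exists x, g x = y) ->
    exists h : {linear P -> A}, forall x, g (h x) = f x.

Definition has_projective_resolution N (p : nat) :=
  exists (P : nat -> lmodType R) (d : forall i, {linear P i.+1 -> P i})
         (e : {linear P 0%N -> V}),
    (forall i, projective (P i)) /\
    (forall v, N v <-> exists x, e x = v) /\
    (forall x, e x = 0 <-> exists y, d 0%N y = x) /\
    (forall i x, d i x = 0 <-> exists y, d i.+1 y = x) /\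
    (forall i, (p < i)%N -> forall x : P i, x = 0).

Definition is_pd N (p : nat) :=
  has_projective_resolution N p /\
  forall q, has_projective_resolution N q -> (p <= q)%N.

End Modules.

Section Ideals.

Variable R : comNzRingType.
Implicit Types I J : R -> Prop.

Definition is_ideal I :=
  [/\ I 0, forall x y, I x -> I y -> I (x + y) & forall c x, I x -> I (c * x)].

Definition ideal_one : R -> Prop := fun=> True.

Definition ideal_mul I J : R -> Prop := fun x =>
  exists (r : nat) (u v : 'I_r -> R),
    [/\ forall k, I (u k), forall k, J (v k) & x = \sum_k u k * v k].

Definition ideal_exp I (a : nat) : R -> Prop := iter a (ideal_mul I) ideal_one.

Definition ideal_monomial (m : nat) (I : 'I_m -> R -> Prop) (a : 'I_m -> nat) :
    R -> Prop :=
  \big[ideal_mul/ideal_one]_(i < m) ideal_exp (I i) (a i).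

End Ideals.

Section Graded.

Variables (K : fieldType) (n : nat).
Local Notation R := {mpoly K[n]}.
Implicit Types I : R -> Prop.

Definition poly_hom (e : nat) (p : R) : Prop := p \is e.-homog.

Definition homogeneous_ideal I :=
  is_ideal I /\ forall p e, I p -> I (pihomog mdeg e p).

(* Homogeneous elements of degree e in the graded free module
   R(-s_0) (+) ... (+) R(-s_(r-1)). *)
Definition free_hom (r : nat) (s : 'I_r -> nat) (e : nat) (v : 'rV[R]_r) :=
  forall k, ((s k <= e)%N -> v 0 k \is (e - s k).-homog) /\
            ((e < s k)%N -> v 0 k = 0).

(* The data  ... -> F_1 -> F_0 -> R  with F_j the free module of row vectors
   whose basis vectors have degrees [res_deg j]; the differential
   F_(j+1) -> F_j is v |-> v *m res_map j.  Submodules of F_j are generated in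
   nonnegative degrees, so shifts in nat suffice. *)
Record resolution := Resolution {
  res_rank : nat -> nat;
  res_deg : forall j, 'I_(res_rank j) -> nat;
  res_aug : 'I_(res_rank 0) -> R;
  res_map : forall j, 'M[R]_(res_rank j.+1, res_rank j)
}.

(* The basis of F_j is mapped to a minimal homogeneous generating system of the
   j-th syzygy module, the 0-th one being I. *)
Definition minimal_resolution I (F : resolution) :=
  [/\ @minimal_hom_gens R R^o poly_hom I _ (@res_deg F 0) (@res_aug F),
      minimal_hom_gens (free_hom (@res_deg F 0))
        (fun v : 'rV[R]_(res_rank F 0) => \sum_k v 0 k * @res_aug F k = 0)
        (@res_deg F 1) (fun k => row k (res_map F 0))
    & forall j, minimal_hom_gens (free_hom (@res_deg F j.+1))
        (fun v : 'rV[R]_(res_rank F j.+1) => v *m res_map F j = 0)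
        (@res_deg F j.+2) (fun k => row k (res_map F j.+1))].

Definition res_top (F : resolution) (j : nat) : extended int :=
  \big[Order.max/@ENInf int]_(k < res_rank F j) EFin (res_deg k)%:Z.

(* Minimal graded free resolutions exist and their ranks and shifts are
   independent of choices, so [epsilon] picks the only possible value; for
   j > pd it is the empty maximum -oo. *)
Definition tdeg (j : nat) I : extended int :=
  epsilon (inhabits (@ENInf int))
    (fun t => exists2 F, minimal_resolution I F & t = res_top F j).

Definition is_regularity I (r : extended int) :=
  (exists j : nat, r = tdeg j I + EFin (- j%:Z)) /\
  (forall j : nat, (tdeg j I + EFin (- j%:Z) <= r)%O).

End Graded.

Definition eventually (m : nat) (P : ('I_m -> nat) -> Prop) :=
  exists b : 'I_m -> nat, forall a, (forall i, (b i <= a i)%N) -> P a.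

Definition linear_fun (m : nat) (c : 'I_m -> nat) (c0 : int) (a : 'I_m -> nat) :
    int :=
  \sum_i (c i)%:Z * (a i)%:Z + c0.

(* Main.v *)
From HB Require Import structures.
From Stdlib Require Import ClassicalEpsilon FunctionalExtensionality.
From Stdlib Require Import PropExtensionality.
From mathcomp Require Import freeg.
Require Import Defs.
From mathcomp Require Import all_boot all_order all_algebra.
From mathcomp Require Import zify.

Set Implicit Arguments.
Unset Strict Implicit.
Unset Printing Implicit Defensive.

Import Order.TTheory GRing.Theory Num.Theory.
(** The proof identifies [tdeg j] with a Koszul homology, and sees the
    Koszul homology of all the products [I^a] at once as a multigraded module
    over one polynomial ring.

    Let R = K[x_1,...,x_n] and let I be a homogeneous ideal.  Tensoring a
    minimal free resolution F of I with the Koszul complex of x_1,...,x_n shows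
    that the degrees of the basis of F_j are the degrees in which H_j(x; I) is
    not zero.  This is carried out by dimension shifting along the syzygies
    ([khomology_deg_shift], [khomology0_gens]): the Koszul complex of a free
    module is exact, and minimality says that the syzygies lie in the
    irrelevant ideal times F_j.  Hence [tdeg j I] is the largest degree of
    H_j(x; I) ([tdeg_eq_max]); it does not depend on the resolution and it is
    -oo for j >= n > 0 ([ideal_homology_top]).  The same shift along an arbitrary
    projective resolution bounds its length from below
    ([khomology_projective_resolution]), which gives the projective dimension.

    Let S = K[x, T] have one variable T_v for each given generator f_v of one
    of the I_i.  Give x_t the weight 1 and the multidegree 0, and give T_v the
    weight deg f_v and the i-th unit vector as multidegree.  The
    specialization T_v |-> f_v maps the part of multidegree a of S onto I^a
    ([rees_monomial]).  Chains of the j-th Koszul module with values in the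
    I^a lift to vectors over S; let U be the lifts of cycles and V the lifts of
    boundaries.  Then H_j(x; I^a) is not zero in degree e exactly when U and V
    differ in multidegree a and weight e, which happens exactly when some
    leading monomial of U in that degree is not one of V ([lead_reduction],
    [rees_homology]).  Koszul homology is killed by the x_t, so multiplication
    by x_t carries leading monomials of U to leading monomials of V.

    What remains is combinatorial.  The exponents of the leading monomials of
    U that are not leading monomials of V form the difference of two upward
    closed sets, and membership in it depends only on the exponents truncated
    at some bound B ([difference_clip]).  The difference is therefore a finite
    union of boxes u + N^Z, where Z contains no x_t.  In large multidegree a
    box is empty unless Z contains, for each i, a generator of I_i; otherwise
    the largest weight in the box is obtained by putting all the remaining
    multidegree a_i on a generator of largest degree in Z.  This is a linear
    function of a whose coefficients are degrees of generators
    ([max_weight_linear]).  The finiteness of the number of boxes gives the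
    supremum of finitely many linear functions. *)

(** * Truncated exponents: Dickson's lemma *)

Local Open Scope nat_scope.

Definition upclosed N (P : ('I_N -> nat) -> Prop) :=
  forall u v, (forall i, u i <= v i) -> P u -> P v.

Definition clip N B (u : 'I_N -> nat) : 'I_N -> nat := fun i => minn B (u i).

(** A form of Dickson's lemma that avoids minimal elements.  Slicing along the
    first coordinate gives an increasing sequence of upward closed sets [Pt t];
    by induction their union is determined by its points in a finite cube, each
    of which is reached at some t, so that the sequence is constant from some T
    on. *)
Lemma upclosed_clip N (P : ('I_N -> nat) -> Prop) :
  upclosed P -> exists B, forall u, P u -> P (clip B u).
Proof.
elim: N P => [|N IHN] P upP; first by exists 0 => u; apply: upP => -[].
pose cons t (u : 'I_N -> nat) : 'I_N.+1 -> nat :=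
  fun i => if unlift ord0 i is Some j then u j else t.
have le_cons t t' u u' : t <= t' -> (forall i, u i <= u' i) ->
    forall i, cons t u i <= cons t' u' i.
  by move=> let' leu i; rewrite /cons; case: unliftP.
pose Pt t u := P (cons t u); pose Pinf u := exists t, Pt t u.
have upPt t : upclosed (Pt t).
  by move=> u v leuv; apply: upP; apply: le_cons.
have [|Binf clipinf] := IHN Pinf.
  by move=> u v leuv [t Ptu]; exists t; apply: upPt Ptu.
have /fin_all_exists[T_ defT] (c : {ffun 'I_N -> 'I_Binf.+1}) :
    exists T, Pinf (fun i => c i : nat) -> Pt T (fun i => c i : nat).
  case: (classic (Pinf (fun i => c i : nat))) => [[t Ptc]|nP]; first by exists t.
  by exists 0.
pose T := \max_c T_ c.
have PT u : Pinf u -> Pt T (clip Binf u).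
  (* the truncation of u is a point of the finite cube *)
  move=> /clipinf; pose c := [ffun i => inord (clip Binf u i)] : {ffun 'I_N -> 'I_Binf.+1}.
  have def_c : (fun i => c i : nat) = clip Binf u.
    by apply: functional_extensionality => i; rewrite ffunE inordK // ltnS geq_minl.
  rewrite -def_c => /defT; apply: upP; apply: le_cons => //.
  exact: leq_bigmax.
have /fin_all_exists[Bt clipt] (t : 'I_T.+1) := IHN (Pt t) (upPt t).
exists (maxn T (maxn Binf (\max_t Bt t))) => u.
set B := maxn _ _.
have def_u i : u i = cons (u ord0) (fun j => u (lift ord0 j)) i.
  by rewrite /cons; case: unliftP => [j|] ->.
move=> Pu; have {}Pu : Pt (u ord0) (fun j => u (lift ord0 j)).
  by apply: upP Pu => i; rewrite -def_u.
have clip_u i : clip B u i =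
    cons (minn B (u ord0)) (clip B (fun j => u (lift ord0 j))) i.
  by rewrite /clip def_u /cons; case: unliftP.
case: (leqP (u ord0) T) => [leT|ltT].
  have := clipt (Ordinal (leT : u ord0 < T.+1)) _ Pu.
  apply: upP => i; rewrite clip_u; apply: le_cons => [|j] /=; first by lia.
  have leB : Bt (Ordinal (leT : u ord0 < T.+1)) <= \max_t Bt t by apply: leq_bigmax.
  by rewrite /clip; lia.
have /PT : Pinf (fun j => u (lift ord0 j)) by exists (u ord0).
apply: upP => i; rewrite clip_u; apply: le_cons => [|j]; first by lia.
by rewrite /clip; lia.
Qed.

Lemma clip_iff N (P : ('I_N -> nat) -> Prop) : upclosed P ->
  exists B0, forall B u, B0 <= B -> P u <-> P (clip B u).
Proof.
move=> upP; have [B0 clipP] := upclosed_clip upP; exists B0 => B u leB.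
split=> [/clipP|]; apply: upP => i; rewrite /clip; lia.
Qed.

(** * Largest weights in a difference of upward closed sets *)
Section Boxes.

Variables (N m p : nat) (delta : 'I_N -> nat) (color : 'I_N -> option 'I_m).
Variables U V : 'I_p -> ('I_N -> nat) -> Prop.
Hypothesis upU : forall c, upclosed (U c).
Hypothesis upV : forall c, upclosed (V c).
Hypothesis killU : forall c v u, color v = None -> U c u ->
  V c (fun w => u w + (w == v)).

Definition weight (u : 'I_N -> nat) := \sum_v delta v * u v.
Definition multideg (u : 'I_N -> nat) i := \sum_(v | color v == Some i) u v.

Let Delta c u := U c u /\ ~ V c u.

Lemma multideg_le u i B :
  (forall v, color v = Some i -> u v <= B) -> multideg u i <= N * B.
Proof.
move=> leB; apply: (@leq_trans (\sum_(v | color v == Some i) B)).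
  by apply: leq_sum => v /eqP; apply: leB.
by rewrite sum_nat_const leq_mul2r -[leqRHS]card_ord max_card orbT.
Qed.

Lemma sum_color (F : 'I_N -> nat) : (forall v, color v = None -> F v = 0) ->
  \sum_v F v = \sum_i \sum_(v | color v == Some i) F v.
Proof.
move=> F0; rewrite (exchange_big_dep predT) //=; apply: eq_bigr => v _.
case def_c: (color v) => [i|]; last by rewrite F0 // big1.
by rewrite (eq_bigl (pred1 i)) ?big_pred1_eq // => j; rewrite eq_sym.
Qed.

(** The bound exceeds by one what the two families need.  An uncoloured exponent
    that reaches it can then be lowered without leaving [U], so [killU] puts the
    point into [V]: uncoloured variables are bounded on the difference. *)
Lemma difference_clip : exists B,
  (forall c u, Delta c u <-> Delta c (clip B u)) /\
  (forall c u v, Delta c u -> color v = None -> u v < B).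
Proof.
have /fin_all_exists[BU clipU] c := clip_iff (@upU c).
have /fin_all_exists[BV clipV] c := clip_iff (@upV c).
pose B := (\max_c maxn (BU c) (BV c)).
have leB c : maxn (BU c) (BV c) <= B by apply: leq_bigmax.
exists B.+1; split=> [c u|c u v [Ucu nVcu] cv].
  have [leU leV] : BU c <= B.+1 /\ BV c <= B.+1 by have := leB c; lia.
  by have := clipU c B.+1 u leU; have := clipV c B.+1 u leV; rewrite /Delta; tauto.
rewrite ltnNge; apply/negP => ltB; apply: nVcu.
have leBU : BU c <= B by have := leB c; lia.
have UB : U c (clip B u) by apply/(clipU c B u leBU).
apply: upV (killU cv UB) => w; rewrite /clip.
case: eqP => [->|_]; lia.
Qed.

(** The indices [k] are the corners [y] of the boxes that meet every large
    multidegree: those where for each colour i some variable of colour i has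
    reached the bound [B].  The i-th coefficient is the largest weight of such a
    variable, and the constant term makes the function take the value
    [weight (kap y)] at the multidegree of the corner. *)
Lemma max_weight_linear :
  exists b (lam : 'I_b -> 'I_m -> nat) (lam0 : 'I_b -> int),
    (forall k i, exists v, color v = Some i /\ lam k i = delta v) /\
    eventually (fun a =>
      (forall c u, Delta c u -> multideg u =1 a ->
         exists k, ((weight u)%:Z <= linear_fun (lam k) (lam0 k) a)%R) /\
      (forall k, exists c u, [/\ Delta c u, multideg u =1 a &
         Posz (weight u) = linear_fun (lam k) (lam0 k) a])).
Proof.
have [B [clipD freeD]] := difference_clip.
pose box := ('I_p * {ffun 'I_N -> 'I_B.+1})%type.
pose kap (y : box) : 'I_N -> nat := fun v => y.2 v.
pose good (y : box) := Delta y.1 (kap y) /\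
  forall i, exists v, color v = Some i /\ kap y v = B.
pose J := [pred y : box | if excluded_middle_informative (good y) then true else false].
have JP y : reflect (good y) (y \in J).
  by rewrite inE; case: excluded_middle_informative => h; constructor.
pose D (y : box) i := \max_(v | (color v == Some i) && (kap y v == B)) delta v.
have Dex y i : good y -> exists v, [/\ color v = Some i, kap y v = B & D y i = delta v].
  move=> [_ /(_ i)[v [cv kv]]].
  have [|w] := @eq_bigmax_cond _ [pred v | (color v == Some i) && (kap y v == B)] delta.
    by apply/card_gt0P; exists v; rewrite !inE cv kv !eqxx.
  by rewrite inE => /andP[/eqP cw /eqP kw] defD; exists w.
pose lam (k : 'I_#|J|) i := D (enum_val k) i.
pose lam0 (k : 'I_#|J|) : int := ((weight (kap (enum_val k)))%:Z
  - (\sum_i lam k i * multideg (kap (enum_val k)) i)%N%:Z)%R.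
have linE k a : linear_fun (lam k) (lam0 k) a =
  ((weight (kap (enum_val k)) + \sum_i lam k i * a i)%N%:Z
   - (\sum_i lam k i * multideg (kap (enum_val k)) i)%N%:Z)%R.
  rewrite /linear_fun /lam0 PoszD addrC addrAC; congr (_ + _ - _)%R.
  by rewrite -natz natr_sum; apply: eq_bigr => i _; rewrite natz PoszM.
have kap_le y i : multideg (kap y) i <= N * B.
  by apply: multideg_le => v _; rewrite -ltnS ltn_ord.
exists #|J|, lam, lam0; split=> [k i|].
  have [|v [cv _ defD]] := @Dex (enum_val k) i; last by exists v.
  by apply/JP/enum_valP.
(* beyond N * B every colour has a variable of exponent at least B *)
exists (fun=> (N * B).+1) => a lea; split=> [c u Du mdu|k].
  pose y : box := (c, [ffun v => inord (clip B u v)]).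
  have kapE v : kap y v = minn B (u v).
    by rewrite /kap ffunE inordK // ltnS geq_minl.
  have kap_y : kap y = clip B u by apply: functional_extensionality.
  have Jy : y \in J.
    apply/JP; split=> [|i]; first by rewrite kap_y -clipD.
    case: (pickP [pred v | (color v == Some i) && (B <= u v)]) => [v|none].
      by case/andP=> /eqP cv leB; exists v; rewrite kapE; split=> //; lia.
    suff : multideg u i <= N * B by have := lea i; rewrite mdu; lia.
    apply: multideg_le => v cv; have /= := none v.
    by rewrite cv eqxx /=; lia.
  exists (enum_rank_in Jy y); rewrite linE enum_rankK_in //.
  rewrite /lam enum_rankK_in //.
  have -> : weight u = weight (kap y) + \sum_v delta v * (u v - kap y v).
    rewrite -big_split; apply: eq_bigr => v _ /=; rewrite -mulnDr kapE.
    by congr (_ * _); lia.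
  rewrite (sum_color (F := fun v => delta v * (u v - kap y v))) => [|v cv].
    rewrite lerBrDr -PoszD lez_nat -addnA leq_add2l -big_split leq_sum // => i _ /=.
    rewrite -mdu /multideg !big_distrr -big_split leq_sum // => v cv /=.
    rewrite kapE; have [leB|ltB] := leqP (u v) B.
      by rewrite subnn muln0.
    have leD : delta v <= D y i.
      apply: (@leq_bigmax_cond _ _ delta v).
      by rewrite cv kapE (minn_idPl (ltnW ltB)) /=.
    apply: leq_trans (_ : D y i * (u v - B) + D y i * B <= _).
      by rewrite leq_add2r leq_mul2r leD orbT.
    by rewrite -mulnDr subnK // ltnW.
  have := freeD _ _ _ Du cv; rewrite kapE => ltB.
  by rewrite (minn_idPr (ltnW ltB)) subnn muln0.
have /JP good_y := enum_valP k; move: (good_y) => [Dy _].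
set y := enum_val k in good_y Dy *.
have /fin_all_exists[w wP] i := @Dex y i good_y.
(* all the missing multidegree goes to the heaviest free variable of each colour *)
pose ext v i := (v == w i) * (a i - multideg (kap y) i).
pose u v := kap y v + \sum_i ext v i.
have clipu : clip B u = kap y.
  apply: functional_extensionality => v; rewrite /clip /u.
  have : kap y v <= B by rewrite -ltnS ltn_ord.
  rewrite leq_eqVlt => /orP[/eqP->|ltB]; first by lia.
  rewrite big1 => [|i _]; first by lia.
  rewrite /ext; case: eqP => // def_v; have [_ kw _] := wP i.
  by rewrite def_v kw ltnn in ltB.
have lea' i : multideg (kap y) i <= a i.
  by have := lea i; have := kap_le y i; lia.
exists y.1, u; split.
- by apply/clipD; rewrite clipu.
- move=> i; rewrite /multideg big_split exchange_big (bigD1 i) //=.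
  rewrite [X in _ + (X + _)](bigD1 (w i)) /=; last by have [-> _ _] := wP i.
  rewrite {1}/ext eqxx mul1n [X in _ + (_ + X + _)]big1 => [|v]; last first.
    by rewrite /ext => /andP[_ /negPf->].
  rewrite [X in _ + (_ + 0 + X)]big1 => [|j ne_ji].
    by rewrite !addn0; apply: subnKC (lea' i).
  apply: big1 => v /eqP cv; rewrite /ext; case: eqP => // def_v.
  have [cw _ _] := wP j.
  by move: cv; rewrite def_v cw => -[def_j]; rewrite def_j eqxx in ne_ji.
- rewrite linE -/y; have -> : weight u = weight (kap y) +
      \sum_i D y i * (a i - multideg (kap y) i).
    rewrite /weight.
    under eq_bigr do rewrite mulnDr.
    rewrite big_split /=; congr (_ + _).
    under eq_bigr do rewrite big_distrr.
    rewrite exchange_big; apply: eq_bigr => i _ /=.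
    rewrite (bigD1 (w i)) //= /ext eqxx mul1n big1 => [|v /negPf->]; last by rewrite mul0n muln0.
    by have [_ _ ->] := wP i; rewrite addn0.
  apply/eqP; rewrite eq_sym subr_eq -PoszD eqz_nat -addnA -big_split.
  apply/eqP; congr (_ + _); apply: eq_bigr => i _ /=.
  by rewrite -mulnDr subnK.
Qed.

End Boxes.

Local Open Scope ring_scope.

(** * The Koszul complex *)

(** The rank of the i-th Koszul module on k elements, by the recursion of
    Pascal's triangle. *)
Fixpoint krank (k i : nat) : nat :=
  match k, i with
  | 0, 0 => 1
  | 0, _.+1 => 0
  | k'.+1, 0 => krank k' 0
  | k'.+1, i'.+1 => krank k' i'.+1 + krank k' i'
  end.

Lemma krank0 k : krank k 0 = 1%N.
Proof. by elim: k. Qed.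

Lemma krank0_single k : exists a0 : 'I_(krank k 0), forall a, a = a0.
Proof. by rewrite krank0; exists ord0 => a; rewrite ord1. Qed.

Lemma krank_top k i : (k < i)%N -> krank k i = 0%N.
Proof.
elim: k i => [|k IHk] [|i] //= ltki.
by rewrite !IHk // ltnW.
Qed.

Section KoszulMatrices.

Variables (R : comNzRingType) (x : nat -> R).

(** The differentials of the Koszul complex of x_0,...,x_(k-1), acting on
    columns.  Adjoining x_k turns a complex C into the mapping cone of
    multiplication by x_k on C, so that (a, b) |-> (d a + s x_k b, d b) with a
    sign s that alternates with the degree. *)
Fixpoint kmx (k : nat) : forall i, 'M[R]_(krank k i, krank k i.+1) :=
  match k return forall i, 'M[R]_(krank k i, krank k i.+1) with
  | 0 => fun i => 0
  | k'.+1 => fun i =>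
    match i return 'M[R]_(krank k'.+1 i, krank k'.+1 i.+1) with
    | 0 => row_mx (kmx k' 0) (x k')%:M
    | i'.+1 => block_mx (kmx k' i'.+1) ((-1) ^+ i'.+1 * x k')%:M
                        0 (kmx k' i')
    end
  end.

(** Serves both for the degree of the entries and for the ideal that contains
    them. *)
Lemma kmx_entry (P : R -> Prop) k i a b :
  P 0 -> (forall t s, (t < k)%N -> P ((-1) ^+ s * x t)) -> P (kmx k i a b).
Proof.
move=> P0; elim: k i a b => [|k IHk] i a b Px; first by rewrite mxE.
have Px' t s : (t < k)%N -> P ((-1) ^+ s * x t) by move=> ltk; apply/Px/ltnW.
have Pk s r (c d : 'I_r) : P ((((-1) ^+ s * x k)%:M : 'M[R]_r) c d).
  by rewrite mxE; case: (c == d); rewrite ?mulr1n ?mulr0n //; apply: Px.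
case: i a b => [|i] a b /=.
  rewrite mxE; case: split => c; first exact: IHk.
  by have := Pk 0%N _ a c; rewrite mul1r; apply.
rewrite mxE; case: split => c; rewrite mxE; case: split => e.
- exact: IHk.
- exact: Pk.
- by rewrite mxE.
- exact: IHk.
Qed.

Lemma kmx_sq k i : kmx k i *m kmx k i.+1 = 0.
Proof.
elim: k i => [|k IHk] [|i] /=; rewrite ?mul0mx //.
- rewrite mul_row_block IHk mulmx0 addr0 mul_mx_scalar mul_scalar_mx.
  by rewrite expr1 mulN1r scaleNr addNr row_mx0.
- rewrite mulmx_block !IHk !mulmx0 !mul0mx !addr0 mul_mx_scalar.
  rewrite mul_scalar_mx -scalerDl (exprS _ i.+1) mulN1r mulNr addNr scale0r.
  by rewrite block_mx0.
Qed.

(** A homotopy from multiplication by x_t to 0: on the cone that adjoins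
    x_t it moves the component of C to the shifted copy of C, and it extends
    diagonally to the later cones. *)
Fixpoint khx (t k : nat) : forall i, 'M[R]_(krank k i.+1, krank k i) :=
  match k return forall i, 'M[R]_(krank k i.+1, krank k i) with
  | 0 => fun i => 0
  | k'.+1 => fun i =>
    match i return 'M[R]_(krank k'.+1 i.+1, krank k'.+1 i) with
    | 0 => if t == k' then col_mx 0 1%:M else col_mx (khx t k' 0) 0
    | i'.+1 => if t == k' then block_mx 0 0 ((-1) ^+ i'.+1)%:M 0
               else block_mx (khx t k' i'.+1) 0 0 (khx t k' i')
    end
  end.

Lemma khx_homotopy t k : (t < k)%N ->
  kmx k 0 *m khx t k 0 = (x t)%:M /\
  forall i, kmx k i.+1 *m khx t k i.+1 + khx t k i *m kmx k i = (x t)%:M.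
Proof.
elim: k => // k IHk ltk; case: (eqVneq t k) => [->|ne_tk] /=.
  have signK i : (-1) ^+ i * x k * (-1) ^+ i = x k.
    by rewrite mulrAC -exprD addnn -mul2n exprM sqrrN !expr1n mul1r.
  split=> [|[|i]] /=; rewrite !eqxx.
  - by rewrite mul_row_col mulmx0 add0r mulmx1.
  - rewrite mulmx_block mul_col_row !(mulmx0, mul0mx, addr0, add0r, mul1mx).
    rewrite !mul_mx_scalar scale_scalar_mx [_ * ((-1) ^+ 1 * _)]mulrC signK.
    by rewrite add_block_mx !(addr0, add0r) expr1 scaleN1r addNr -scalar_mx_block.
  - rewrite !mulmx_block !(mulmx0, mul0mx, addr0, add0r) -!scalar_mxM signK.
    rewrite mulrC signK mul_mx_scalar mul_scalar_mx add_block_mx.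
    rewrite !(addr0, add0r) (exprS _ i.+1) mulN1r scaleNr addNr.
    by rewrite -scalar_mx_block.
have {}/IHk [IH0 IHS] : (t < k)%N by rewrite ltn_neqAle ne_tk -ltnS.
split=> [|[|i]] /=; rewrite !(negPf ne_tk).
- by rewrite mul_row_col mulmx0 addr0.
- rewrite mulmx_block mul_col_row !(mulmx0, mul0mx, addr0, add0r).
  rewrite add_block_mx IHS ?addr0 ?add0r IH0 mul_mx_scalar mul_scalar_mx.
  by rewrite expr1 mulN1r scaleNr addNr -scalar_mx_block.
- rewrite !mulmx_block !(mulmx0, mul0mx, addr0, add0r) add_block_mx !IHS.
  rewrite !(addr0, add0r) mul_mx_scalar mul_scalar_mx -scalerDl.
  by rewrite (exprS _ i.+1) mulN1r mulNr addNr scale0r -scalar_mx_block.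
Qed.

(** Exactness for a regular sequence, by induction along the cones: a cycle
    (a, b) has a boundary as second component, by induction or, in the lowest
    degree, by regularity; subtracting the boundary of a preimage leaves a cycle in
    the first component.
    The hypothesis is the regularity of the sequence, as the image of
    [kmx t 0] is the ideal generated by x_0,...,x_(t-1). *)
Lemma kmx_exact k :
  (forall t (b : 'cV_(krank t 0)) (c : 'cV_(krank t 1)), (t < k)%N ->
     x t *: b = kmx t 0 *m c ->
     exists c' : 'cV_(krank t 1), kmx t 0 *m c' = b) ->
  forall i (z : 'cV[R]_(krank k i.+1)),
    kmx k i *m z = 0 -> exists w, kmx k i.+1 *m w = z.
Proof.
elim: k => [|k IHk] reg i z /=.
  by move=> _; exists 0; apply/matrixP => -[].
have {}IHk := IHk (fun t b c ltk => reg t b c (ltnW ltk)).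
move: z => /=; case: i => [|i] z; rewrite -[z]vsubmxK /=.
  rewrite mul_row_col mul_scalar_mx => eq_ab.
  have [|c' def_b] := reg k (dsubmx z) (- usubmx z) (ltnSn k).
    by apply/eqP; rewrite mulmxN -addr_eq0 addrC eq_ab.
  have /IHk [w def_a] : kmx k 0 *m (usubmx z + x k *: c') = 0.
    by rewrite mulmxDr -scalemxAr def_b.
  exists (col_mx w c'); rewrite mul_block_col mul0mx add0r def_a def_b.
  by rewrite mul_scalar_mx expr1 mulN1r scaleNr addrK.
rewrite mul_block_col mul0mx add0r => /eqP; rewrite col_mx_eq0.
case/andP => /eqP eq_a /eqP/IHk [b' def_b].
have /IHk [w def_a] : kmx k i.+1 *m (usubmx z - (-1) ^+ i.+2 * x k *: b') = 0.
  rewrite mulmxBr -scalemxAr def_b; apply/eqP; rewrite subr_eq0; apply/eqP.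
  move/eqP: eq_a; rewrite addr_eq0 mul_scalar_mx => /eqP->.
  by rewrite (exprS _ i.+1) mulN1r mulNr scaleNr.
exists (col_mx w b'); rewrite mul_block_col mul0mx add0r def_a def_b.
by rewrite mul_scalar_mx subrK.
Qed.
End KoszulMatrices.

(** * Koszul homology of submodules *)

Lemma pred_ext (T : Type) (P Q : T -> Prop) : (forall v, P v <-> Q v) -> P = Q.
Proof.
move=> eqPQ; apply: functional_extensionality => v.
exact: propositional_extensionality.
Qed.

Section Submodules.

Variables (R : comNzRingType) (V : lmodType R).

Definition submodule (N : V -> Prop) :=
  [/\ N 0, forall u v, N u -> N v -> N (u + v) & forall c v, N v -> N (c *: v)].

Variables (N : V -> Prop) (subN : submodule N).

Lemma submod0 : N 0. Proof. by case: subN. Qed.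
Lemma submodD u v : N u -> N v -> N (u + v).
Proof. by case: subN => _ + _; apply. Qed.
Lemma submodZ c v : N v -> N (c *: v).
Proof. by case: subN => _ _; apply. Qed.
Lemma submod_sum (J : finType) (P : pred J) (F : J -> V) :
  (forall j, P j -> N (F j)) -> N (\sum_(j | P j) F j).
Proof. by move=> NF; apply: big_ind => //; [apply: submod0 | apply: submodD]. Qed.

End Submodules.

Section MatrixAction.

Variable R : comNzRingType.

(** The Koszul complex with coefficients in [V] comes from the matrices over [R]
    through this action on columns. *)
Definition mact (V : lmodType R) p q (A : 'M[R]_(p, q)) (w : 'I_q -> V) a :=
  \sum_b A a b *: w b.

Variables V W : lmodType R.
Implicit Types (p q r : nat).

Lemma mact_ext p q (A : 'M[R]_(p, q)) (w w' : 'I_q -> V) :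
  w =1 w' -> mact A w =1 mact A w'.
Proof. by move=> eqw a; apply: eq_bigr => b _; rewrite eqw. Qed.

Lemma mactM p q r (A : 'M[R]_(p, q)) (B : 'M_(q, r)) (w : 'I_r -> V) a :
  mact (A *m B) w a = mact A (mact B w) a.
Proof.
rewrite /mact; under [RHS]eq_bigr do rewrite scaler_sumr.
rewrite exchange_big; apply: eq_bigr => c _ /=.
by rewrite mxE scaler_suml; apply: eq_bigr => b _; rewrite scalerA.
Qed.

Lemma mactDl p q (A B : 'M[R]_(p, q)) (w : 'I_q -> V) a :
  mact (A + B) w a = mact A w a + mact B w a.
Proof. by rewrite -big_split; apply: eq_bigr => b _; rewrite mxE scalerDl. Qed.

Lemma mact0l p q (w : 'I_q -> V) a : mact (0 : 'M[R]_(p, q)) w a = 0.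
Proof. by apply: big1 => b _; rewrite mxE scale0r. Qed.

Lemma mact0 p q (A : 'M[R]_(p, q)) (w : 'I_q -> V) a :
  (forall b, w b = 0) -> mact A w a = 0.
Proof. by move=> w0; apply: big1 => b _; rewrite w0 scaler0. Qed.

Lemma mact_scalar p c (w : 'I_p -> V) a : mact c%:M w a = c *: w a.
Proof.
rewrite /mact (bigD1 a) //= mxE eqxx big1 ?addr0 // => b ne_ba.
by rewrite mxE eq_sym (negPf ne_ba) scale0r.
Qed.

Lemma mactB p q (A : 'M[R]_(p, q)) (w w' : 'I_q -> V) a :
  mact A (fun b => w b - w' b) a = mact A w a - mact A w' a.
Proof. by rewrite -sumrB; apply: eq_bigr => b _; rewrite scalerBr. Qed.

Lemma mact_linear p q (A : 'M[R]_(p, q)) (g : {linear V -> W}) w a :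
  g (mact A w a) = mact A (g \o w) a.
Proof. by rewrite linear_sum; apply: eq_bigr => b _; rewrite linearZ. Qed.

Lemma mact_submod (N : V -> Prop) p q (A : 'M[R]_(p, q)) (w : 'I_q -> V) a :
  submodule N -> (forall b, N (w b)) -> N (mact A w a).
Proof. by move=> subN Nw; apply: submod_sum => // b _; apply: submodZ. Qed.

End MatrixAction.

Section KoszulHomology.

Variables (R : comNzRingType) (x : nat -> R) (n : nat).
Local Notation D := (kmx x n).

(** The chains of degree i of the Koszul complex of a submodule [N] of [V] are
    the columns with entries in [N].  The ambient module stays in sight because
    boundaries in [V] need not be boundaries in [N]. *)
Definition kcycle (V : lmodType R) (N : V -> Prop) i
    (z : 'I_(krank n i) -> V) : Prop :=
  (forall a, N (z a)) /\
  match i return ('I_(krank n i) -> V) -> Prop with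
  | 0 => fun=> True
  | i'.+1 => fun z => forall a, mact (D i') z a = 0
  end z.

Definition kboundary (V : lmodType R) (N : V -> Prop) i
    (z : 'I_(krank n i) -> V) : Prop :=
  exists w : 'I_(krank n i.+1) -> V,
    (forall b, N (w b)) /\ forall a, mact (D i) w a = z a.

Definition kexact (V : lmodType R) := forall i (z : 'I_(krank n i.+1) -> V),
  (forall a, mact (D i) z a = 0) -> exists w, forall a, mact (D i.+1) w a = z a.

(** The homotopy [khx] has coefficients in R, hence preserves [N]. *)
Lemma kcycle_kill (V : lmodType R) (N : V -> Prop) t i z :
  submodule N -> (t < n)%N -> @kcycle V N i z ->
  kboundary N (fun a => x t *: z a).
Proof.
move=> subN ltn; have [h0 hS] := khx_homotopy x ltn.
case: i z => [|i] z [Nz cz].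
  exists (mact (khx R t n 0) z); split=> [b|a]; first exact: mact_submod.
  by rewrite -mactM h0 mact_scalar.
exists (mact (khx R t n i.+1) z); split=> [b|a]; first exact: mact_submod.
rewrite -mact_scalar -(hS i) mactDl !mactM [X in _ + X]mact0 ?addr0 //.
Qed.

(** In the top degree there are no boundaries, so [kcycle_kill] gives
    x_0 z = 0 for a cycle z. *)
Lemma kcycle_top (V : lmodType R) (N : V -> Prop) z : submodule N ->
  (0 < n)%N -> (forall v : V, x 0%N *: v = 0 -> v = 0) ->
  @kcycle V N n z -> forall a, z a = 0.
Proof.
move=> subN n_gt0 tf cz a.
have [w [_ /(_ a) def_z]] := kcycle_kill subN n_gt0 cz.
apply: tf; rewrite -def_z; apply: big1 => b.
by have := ltn_ord b; rewrite [X in (_ < X)%N]krank_top.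
Qed.

(** Dimension shifting for 0 -> ker g -> V -> im g -> 0 when the Koszul complex of
    [V] is exact: the connecting map sends the class of g o y to the class of
    the differential of y. *)
Section Shift.

Variables (V W : lmodType R) (g : {linear V -> W}) (exV : kexact V).
Let ker v := g v = 0.
Let im w := exists v, g v = w.

Lemma shift_cycle i (y : 'I_(krank n i.+1) -> V) :
  kcycle im (g \o y) <-> kcycle ker (mact (D i) y).
Proof.
split=> [[_ cz]|[kerw _]].
  split=> [a|]; first by rewrite /ker mact_linear.
  by case: i y cz => // i y cz a; rewrite -mactM kmx_sq mact0l.
split=> [a|a /=]; first by exists (y a).
by rewrite -mact_linear; apply: kerw.
Qed.

Lemma shift_boundary i (y : 'I_(krank n i.+1) -> V) :
  kboundary im (g \o y) <-> kboundary ker (mact (D i) y).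
Proof.
split=> [[w [/fin_all_exists[v gv] def_z]]|[u [keru def_w]]].
  exists (fun b => y b - mact (D i.+1) v b); split=> [b|a].
    rewrite /ker linearB mact_linear (@mact_ext _ _ _ _ _ (g \o v) w) //.
    by rewrite def_z subrr.
  by rewrite mactB -mactM kmx_sq mact0l subr0.
have [a|v def_v] := exV (z := fun b => y b - u b) (i := i).
  by rewrite mactB def_w subrr.
exists (g \o v); split=> [b|a]; first by exists (v b).
by rewrite -mact_linear def_v linearB keru subr0.
Qed.

End Shift.

Definition khomology_neq0 (V : lmodType R) (N : V -> Prop) i :=
  exists2 z : 'I_(krank n i) -> V, kcycle N z & ~ kboundary N z.

Lemma khomology_shift (V W : lmodType R) (g : {linear V -> W}) i :
  kexact V -> khomology_neq0 (fun w => exists v, g v = w) i.+1 ->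
  khomology_neq0 (fun v => g v = 0) i.
Proof.
move=> exV [z cz nbz]; have [/fin_all_exists[y def_z] _] := cz.
have {}def_z : z = g \o y by apply: functional_extensionality => a; rewrite -def_z.
exists (mact (D i) y); first by apply/shift_cycle; rewrite -def_z.
by move/(shift_boundary g exV); rewrite -def_z.
Qed.

Lemma kexact_row r : kexact R^o -> kexact 'rV[R]_r.
Proof.
move=> exR i z cz.
have /fin_all_exists[w def_w] (j : 'I_r) : exists w : 'I_(krank n i.+2) -> R^o,
    forall a, mact (D i.+1) w a = z a 0 j.
  apply: exR => a; have /rowP/(_ j) := cz a.
  by rewrite summxE mxE => <-; apply: eq_bigr => b _; rewrite mxE.
exists (fun b => \row_j w j b) => a; apply/rowP=> j; rewrite -def_w summxE.
by apply: eq_bigr => b _; rewrite !mxE.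
Qed.

Lemma kexact_regular :
  (forall t (b : 'cV_(krank t 0)) (c : 'cV_(krank t 1)), (t < n)%N ->
     x t *: b = kmx x t 0 *m c ->
     exists c' : 'cV_(krank t 1), kmx x t 0 *m c' = b) ->
  kexact R^o.
Proof.
move=> reg i z cz.
have [|w def_w] := kmx_exact reg (z := \col_a z a) (i := i).
  by apply/colP=> a; rewrite !mxE -{2}(cz a); apply: eq_bigr => b _; rewrite mxE.
exists (fun b => w b 0) => a; move/colP/(_ a): def_w; rewrite !mxE => <-.
by [].
Qed.

End KoszulHomology.

(** * Projective resolutions *)
Section Projective.
Variables (R : comNzRingType) (x : nat -> R) (n : nat).

HB.instance Definition _ (V : lmodType R) (K : choiceType) (f : K -> V) :=
  GRing.isAdditive.Build {freeg K / R} V (fglift f) (lift_is_additive f).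

Lemma fglift_is_scalable (V : lmodType R) (K : choiceType) (f : K -> V) :
  scalable (fglift f : {freeg K / R} -> V).
Proof.
move=> c D; rewrite -{2}[D]freeg_sumE [c *: D]/(fgscale c D) /fgscale !raddf_sum.
by apply: eq_bigr => k _ /=; rewrite !liftU scalerA.
Qed.
HB.instance Definition _ (V : lmodType R) (K : choiceType) (f : K -> V) :=
  GRing.isScalable.Build R {freeg K / R} V *:%R (fglift f) (fglift_is_scalable f).

(** A chain involves finitely many basis elements, the set [L] below, and can be
    lifted coordinate by coordinate. *)
Lemma kexact_freeg (K : choiceType) :
  kexact x n R^o -> kexact x n {freeg K / R}.
Proof.
move=> exR i z cz.
have coeff_act p q (A : 'M[R]_(p, q)) (w : 'I_q -> {freeg K / R}) k a :
    coeff k (mact A w a) = mact A (fun b => coeff k (w b) : R^o) a.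
  by rewrite /mact raddf_sum; apply: eq_bigr => b _ /=; rewrite coeffZ.
have ex_w k : exists w : 'I_(krank n i.+2) -> R^o,
    forall a, mact (kmx x n i.+1) w a = coeff k (z a).
  by apply: exR => a; rewrite -coeff_act cz coeff0.
pose w k := sval (constructive_indefinite_description _ (ex_w k)).
have def_w k : forall a, mact (kmx x n i.+1) (w k) a = coeff k (z a).
  by rewrite /w; case: constructive_indefinite_description.
pose L := undup (flatten [seq dom (z a) | a <- enum 'I_(krank n i.+1)]).
exists (fun b => \sum_(k <- L) << w k b *g k >>) => a.
apply/eqP/freeg_eqP => k; rewrite coeff_act.
have coeff_w b : coeff k (\sum_(l <- L) << w l b *g l >>) =
    (k \in L)%:R * w k b.
  rewrite raddf_sum /=; under eq_bigr do rewrite coeffU.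
  have [kL|kL] := boolP (k \in L).
    rewrite (bigD1_seq k) ?undup_uniq //= eqxx mulr1 mul1r big1 ?addr0 //.
    by move=> l /negPf->; rewrite mulr0.
  rewrite mul0r big_seq big1 // => l lL.
  by case: eqP lL kL => [->->|_]; rewrite ?mulr0.
rewrite (mact_ext _ coeff_w).
case: (boolP (k \in L)) => [_|kL].
  by rewrite -def_w; apply: eq_bigr => b _; rewrite mul1r.
rewrite mact0 => [|b]; last by rewrite mul0r.
apply/esym/eqP; apply: contraNT kL; rewrite -mem_dom mem_undup => kz.
by apply/flatten_mapP; exists a; rewrite ?mem_enum.
Qed.

(** A projective module is a retract of the free module on its elements. *)
Lemma kexact_projective (P : lmodType R) :
  kexact x n R^o -> projective P -> kexact x n P.
Proof.
move=> exR projP i z cz.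
have [|s sK] := projP {freeg P / R} P (fglift id) idfun.
  by move=> y; exists << y >>; rewrite /= liftU scale1r.
have [|w def_w] := kexact_freeg exR (z := s \o z) (i := i).
  by move=> a; rewrite -mact_linear cz linear0.
exists (fglift id \o w) => a.
by rewrite -mact_linear def_w /= sK.
Qed.

(** The lower bound for the length of a projective resolution: shifting q + 1
    times moves a class of degree i > q to the kernel of P_q -> P_(q-1), which is
    the image of P_(q+1) = 0. *)
Lemma khomology_projective_resolution (V : lmodType R) (N : V -> Prop) q i :
  kexact x n R^o -> has_projective_resolution N q -> (q < i)%N ->
  ~ khomology_neq0 x n N i.
Proof.
move=> exR [P [d [e [projP [imN [kere [kerd P0]]]]]]] lt_qi nzN.
have exP j : kexact x n (P j) by apply: kexact_projective.
pose ker0 (v : P 0%N) := e v = 0; pose ker j (v : P j.+1) := d j v = 0.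
pose Z j : P j -> Prop := match j with 0 => ker0 | j'.+1 => ker j' end.
have step j k : khomology_neq0 x n (@Z j) k.+1 ->
    khomology_neq0 x n (@Z j.+1) k.
  move=> nz; apply: (khomology_shift (g := d j)) => //.
  rewrite [X in khomology_neq0 x n X](_ : _ = @Z j) //.
  by apply: pred_ext => v; case: j v {nz} => [|j] v; split; first [by move/kere | by move/kerd].
have start : khomology_neq0 x n (@Z 0) i.-1.
  case: i lt_qi nzN => // i _ nz; apply: (khomology_shift (g := e)) => //.
  by rewrite [X in khomology_neq0 x n X](_ : _ = N) //; apply: pred_ext => v; rewrite imN.
have all j : (j < i)%N -> khomology_neq0 x n (@Z j) (i.-1 - j).
  elim: j => [|j IHj] ltji; first by rewrite subn0.
  apply: step; have := IHj (ltnW ltji); congr khomology_neq0.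
  by case: i ltji {lt_qi nzN start IHj} => // i; rewrite ltnS => ltji; rewrite subnSK.
have [z [Zz _] nb] := all q lt_qi.
have Z0 r (v : P r) : (q <= r)%N -> @Z r v -> v = 0.
  case: r v => [|r] v leqr; first by case/kere=> y <-; rewrite (P0 1%N _ y) ?linear0.
  by case/kerd=> y <-; rewrite (P0 r.+2 _ y) ?linear0 // ltnS ltnW.
apply: nb; exists (fun=> 0); split=> [b|a]; last first.
  by rewrite mact0 // (Z0 _ _ (leqnn q) (Zz a)).
by rewrite /Z /ker0 /ker; case: (q) => [|r]; rewrite linear0.
Qed.

End Projective.

(** * Leading terms *)
Section LeadingTerms.

Variables (K : fieldType) (N p : nat).
Local Notation S := {mpoly K[N]}.
Implicit Types (u v : 'rV[S]_p) (U V : 'rV[S]_p -> Prop).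

(** Vectors are ordered by position first: the leading term sits in the first
    nonzero component. *)
Definition has_lead u (c : 'I_p) (mu : 'X_{1..N}) :=
  [/\ forall k : 'I_p, (k < c)%N -> u 0 k = 0, u 0 c != 0 & mlead (u 0 c) = mu].

Definition subspace U :=
  U 0 /\ forall u v (k : K), U u -> U v -> U (u + k%:MP *: v).

Lemma has_lead_mulX u c mu kap :
  has_lead u c mu -> has_lead ('X_[kap] *: u) c (kap + mu)%MM.
Proof.
case=> u0 uc <-; have X_neq0 : 'X_[kap] != 0 :> S.
  by rewrite -msupp_eq0 msuppX.
split=> [k /u0|| ]; rewrite !mxE.
- by move=> ->; rewrite mulr0.
- by rewrite mulf_neq0.
- by rewrite mleadM // mleadXm.
Qed.

(** The division argument of Groebner bases: a vector of [U] is reduced by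
    vectors of [V] with the same leading term.  The induction is on the position
    of the leading term, then on its monomial. *)
Lemma lead_reduction U V : subspace U -> subspace V -> (forall v, V v -> U v) ->
  (forall u c mu, U u -> has_lead u c mu -> exists2 v, V v & has_lead v c mu) ->
  forall u, U u -> V u.
Proof.
move=> [U0 UD] [V0 VD] subVU leadV.
suff aux d u : U u -> (forall k : 'I_p, (k < p - d)%N -> u 0 k = 0) -> V u.
  by move=> u Uu; apply: (aux p) => // k; rewrite subnn.
elim: d u => [|d IHd] u Uu u0.
  suff -> : u = 0 by [].
  by apply/rowP=> k; rewrite mxE u0 // subn0.
have [ltdp|lepd] := ltnP d p; last first.
  by apply: IHd => // k; rewrite (eqP (lepd : (p - d)%N == 0%N)).
have ltc : (p - d.+1 < p)%N by rewrite ltn_subrL (leq_ltn_trans _ ltdp).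
pose c := Ordinal ltc.
have defc : (p - d = c.+1)%N by rewrite /= subnSK.
have [mu le_mu] : exists mu, mu = mlead (u 0 c) by exists (mlead (u 0 c)).
elim/(well_founded_ind (@ltom_wf N)): mu u Uu u0 le_mu => mu IHmu u Uu u0 def_mu.
have IHc (w : 'rV_p) : U w -> (forall k : 'I_p, (k < c)%N -> w 0 k = 0) ->
    w 0 c = 0 -> V w.
  move=> Uw w0 wc; apply: IHd => // k; rewrite defc ltnS leq_eqVlt.
  by case/orP=> [/eqP eq_kc|/w0//]; rewrite (_ : k = c) //; apply: val_inj.
have [uc|uc] := eqVneq (u 0 c) 0; first exact: IHc.
have [v Vv [v0 vc lead_v]] := leadV u c mu Uu (And3 u0 uc (esym def_mu)).
pose k := mleadc (u 0 c) / mleadc (v 0 c).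
pose w := u + (- k)%:MP *: v.
have Vw : V w.
  have Uw : U w by apply/UD/subVU.
  have w0 (l : 'I_p) : (l < c)%N -> w 0 l = 0.
    by move=> ltl; rewrite !mxE u0 // v0 // mulr0 addr0.
  have wcE : w 0 c = u 0 c - k *: v 0 c by rewrite !mxE mul_mpolyC scaleNr.
  have [wc|wc] := eqVneq (w 0 c) 0; first exact: IHc.
  have k_neq0 : k != 0 by rewrite mulf_neq0 ?invr_neq0 ?mleadc_eq0.
  have le_w : (mlead (w 0%R c) <= mu)%O.
    rewrite wcE (le_trans (mleadB_le _ _)) // mleadZ //.
    by rewrite lead_v -def_mu joinxx.
  have ne_w : mlead (w 0 c) != mu.
    apply: contra_neq wc => def_w; apply/eqP; rewrite -mleadc_eq0 def_w wcE.
    rewrite mcoeffB mcoeffZ -{2}lead_v def_mu /k mulfVK ?subrr //.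
    by rewrite mleadc_eq0.
  by apply: (IHmu (mlead (w 0 c))) => //; rewrite lt_neqAle ne_w.
have -> : u = w + k%:MP *: v by rewrite /w mpolyCN scaleNr subrK.
exact: VD.
Qed.

End LeadingTerms.

Section Noetherian.

Variables (K : fieldType) (N p : nat).
Local Notation S := {mpoly K[N]}.

Definition mnm_of (f : 'I_N -> nat) : 'X_{1..N} := [multinom f i | i < N].

Lemma mnm_ofK (mu : 'X_{1..N}) : mnm_of (fun i => mu i) = mu.
Proof. by apply/mnmP=> i; rewrite mnmE. Qed.

Lemma mnm_of_le f f' : (forall i, f i <= f' i)%N ->
  exists kap, mnm_of f' = (kap + mnm_of f)%MM.
Proof.
move=> lef; exists (mnm_of f' - mnm_of f)%MM; rewrite submK //.
by apply/mnm_lepP=> i; rewrite !mnmE.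
Qed.

(** Hilbert's basis theorem: the leading monomials in each position are upward
    closed, hence already determined by those in a finite cube, and vectors
    realizing the latter generate by [lead_reduction]. *)
Lemma noetherian (M : 'rV[S]_p -> Prop) : submodule M ->
  exists r (g : 'I_r -> 'rV[S]_p), generates M g.
Proof.
move=> subM; pose In c f := exists2 u, M u & has_lead u c (mnm_of f).
have upIn c : upclosed (In c).
  move=> f f' /mnm_of_le[kap def_f'] [u Mu lead_u]; rewrite /In def_f'.
  by exists ('X_[kap] *: u); [apply: submodZ | apply: has_lead_mulX].
have /fin_all_exists[B_ clipB] c := upclosed_clip (@upIn c).
pose B := \max_c B_ c.
have leB c : (B_ c <= B)%N by apply: leq_bigmax.
pose box : finType := ('I_p * {ffun 'I_N -> 'I_B.+1})%type.
have /fin_all_exists[h hP] (y : box) : exists u, M u /\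
    (In y.1 (fun i => y.2 i : nat) -> has_lead u y.1 (mnm_of (fun i => y.2 i : nat))).
  have [[u Mu lead_u]|nIn] := classic (In y.1 (fun i => y.2 i : nat)).
    by exists u.
  by exists 0; split=> //; apply: submod0.
exists #|box|, (fun k => h (enum_val k)).
set V := fun v => exists c : 'I_#|box| -> S, v = \sum_k c k *: h (enum_val k).
have VM v : V v -> M v.
  case=> c ->; apply: (submod_sum subM) => k _.
  by apply: (submodZ subM); have [] := hP (enum_val k).
have subV : submodule V.
  split.
  - by exists (fun=> 0); rewrite big1 // => k _; rewrite scale0r.
  - move=> _ _ [c ->] [c' ->]; exists (fun k => c k + c' k).
    by rewrite -big_split; apply: eq_bigr => k _; rewrite scalerDl.
  - move=> a _ [c ->]; exists (fun k => a * c k).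
    by rewrite scaler_sumr; apply: eq_bigr => k _; rewrite scalerA.
have spc W : submodule W -> @subspace K N p W.
  move=> subW; split=> [|u v k Wu Wv]; first exact: (submod0 subW).
  by apply: (submodD subW) => //; apply: (submodZ subW).
move=> v; split; last exact: VM.
apply: (lead_reduction (spc _ subM) (spc _ subV) VM) => u c mu Mu lead_u.
have /clipB Inc : In c (fun i => mu i) by exists u; rewrite ?mnm_ofK.
pose y : box := (c, [ffun i => inord (clip (B_ c) (fun i => mu i) i)]).
have def_y : (fun i => y.2 i : nat) = clip (B_ c) (fun i => mu i).
  apply: functional_extensionality => i; rewrite ffunE inordK // ltnS.
  by rewrite (leq_trans (geq_minl _ _)).
have [_] := hP y; rewrite def_y => /(_ Inc) lead_h.
have [|kap] := @mnm_of_le (clip (B_ c) (fun i => mu i)) (fun i => mu i).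
  by move=> i; apply: geq_minr.
rewrite mnm_ofK => ->; exists ('X_[kap] *: h y); last exact: has_lead_mulX.
apply: (submodZ subV); exists (fun k => (k == enum_rank y)%:R).
rewrite (bigD1 (enum_rank y)) //= eqxx scale1r enum_rankK big1 ?addr0 //.
by move=> k /negPf->; rewrite scale0r.
Qed.

End Noetherian.

(** * Homogeneous components and minimal resolutions *)
Section HomogeneousComponents.

Variables (K : fieldType) (n : nat).
Local Notation R := {mpoly K[n]}.

Lemma pihomogM t (c q : R) e : c \is t.-homog ->
  pihomog mdeg e (c * q) =
    if (t <= e)%N then c * pihomog mdeg (e - t) q else 0.
Proof.
move=> hc; pose k := maxn (mmeasure mdeg q) e.+1.
have def_q : q = \sum_(d < k) pihomog mdeg d q.
  by apply: pihomog_partitionE; apply: leq_maxl.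
have hcq d : c * pihomog mdeg d q \is (t + d).-homog.
  by apply: dhomogM hc _; apply: pihomogP.
rewrite {1}def_q mulr_sumr raddf_sum /=; case: leqP => [let_e|lte].
  have ltek : (e - t < k)%N.
    by rewrite (leq_trans _ (leq_maxr _ _)) // ltnS leq_subr.
  rewrite (bigD1 (Ordinal ltek)) //= big1 ?addr0 => [|d ne_d].
    by rewrite pihomog_dE //; have := hcq (e - t)%N; rewrite subnKC.
  apply: (pihomog_ne0 _ (hcq d)); apply: contra_neq ne_d => def_e.
  by apply/val_inj; rewrite /= -def_e addKn.
apply: big1 => d _; apply: (pihomog_ne0 _ (hcq d)).
by rewrite gtn_eqF // (leq_trans lte) ?leq_addr.
Qed.

Section Shifts.

Variables (r : nat) (s : 'I_r -> nat).
Implicit Types (v w : 'rV[R]_r).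

(** The component of degree e in the graded free module with basis degrees [s];
    below [s k] the k-th coordinate of such a component is 0. *)
Definition hcomp e v : 'rV[R]_r :=
  \row_k (if (s k <= e)%N then pihomog mdeg (e - s k) (v 0 k) else 0).

Lemma hcompD e : {morph hcomp e : v w / v + w}.
Proof.
move=> v w; apply/rowP=> k; rewrite !mxE.
by case: ifP; rewrite ?addr0 // raddfD.
Qed.

Lemma hcomp0 e : hcomp e 0 = 0.
Proof. by apply/rowP=> k; rewrite !mxE raddf0 if_same. Qed.

Lemma hcomp_sum e (J : finType) (P : pred J) (F : J -> 'rV[R]_r) :
  hcomp e (\sum_(j | P j) F j) = \sum_(j | P j) hcomp e (F j).
Proof. exact: (big_morph _ (hcompD e) (hcomp0 e)). Qed.

Lemma hcompP e v : free_hom s e (hcomp e v).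
Proof.
move=> k; rewrite mxE; split=> [->|]; first exact: pihomogP.
by rewrite ltnNge => /negPf->.
Qed.

Lemma hcomp_id e v : free_hom s e v -> hcomp e v = v.
Proof.
move=> hv; apply/rowP=> k; rewrite mxE; case: leqP => [le_se|lt_es].
  by rewrite pihomog_dE //; apply: (hv k).1.
by rewrite (hv k).2.
Qed.

Lemma hcomp_mul t (c : R) e v : c \is t.-homog ->
  hcomp e (c *: v) = if (t <= e)%N then c *: hcomp (e - t) v else 0.
Proof.
move=> hc; apply/rowP=> k; rewrite !mxE (pihomogM _ _ hc).
case: (leqP t e) => [let_e|lt_et]; last first.
  rewrite mxE; case: ifP => // le_se; rewrite leqNgt.
  by rewrite (leq_ltn_trans (leq_subr _ _) lt_et).
rewrite !mxE; have -> : (s k <= e - t = (s k <= e) && (t <= e - s k))%N by lia.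
rewrite subnAC; case: (s k <= e)%N; rewrite ?mulr0 //=.
by case: ifP; rewrite ?mulr0.
Qed.

Lemma hcomp_scale t (c : R) e v : free_hom s t v ->
  hcomp e (c *: v) = if (t <= e)%N then pihomog mdeg (e - t) c *: v else 0.
Proof.
move=> hv; apply/rowP=> k; rewrite !mxE.
have [le_st|lt_ts] := leqP (s k) t; last first.
  rewrite (hv k).2 // mulr0 raddf0 if_same.
  by case: ifP; rewrite mxE // (hv k).2 // mulr0.
case: leqP => [le_se|lt_es]; last first.
  by rewrite leqNgt (leq_trans lt_es le_st) /= mxE.
rewrite mulrC (pihomogM _ _ ((hv k).1 le_st)) leq_sub2rE //.
by case: leqP => _; rewrite !mxE // mulrC subnBA ?subnK.
Qed.

(** Every bound beyond the degree of v will do, so that finitely many vectors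
    can share one. *)
Lemma hcomp_partition v : exists B, forall C, (B <= C)%N -> v = \sum_(e < C) hcomp e v.
Proof.
exists (\max_k (mmeasure mdeg (v 0%R k) + s k))%N => C leBC.
apply/rowP=> k; rewrite summxE.
have leC : (mmeasure mdeg (v 0%R k) + s k <= C)%N.
  apply: leq_trans leBC.
  exact: (@leq_bigmax _ (fun k => mmeasure mdeg (v 0%R k) + s k)%N k).
have le_sC : (s k <= C)%N by rewrite (leq_trans _ leC) ?leq_addl.
have leC' : (mmeasure mdeg (v 0%R k) <= C - s k)%N by rewrite leq_subRL // addnC.
rewrite {1}(pihomog_partitionE leC').
under [RHS]eq_bigr do rewrite mxE.
rewrite -(big_mkord xpredT (fun d => pihomog mdeg d (v 0 k))).
rewrite -(big_mkord xpredT (fun e => if (s k <= e)%N then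
   pihomog mdeg (e - s k) (v 0 k) else 0)) /=.
rewrite [RHS](big_cat_nat _ (n := s k)) //= [X in _ = X + _]big1_seq ?add0r.
  rewrite -{2}[s k]add0n big_addn; apply: eq_bigr => d _.
  by rewrite leq_addl addnK.
by move=> e /=; rewrite mem_index_iota => /= lt_es; rewrite leqNgt lt_es.
Qed.

Definition graded (N : 'rV[R]_r -> Prop) :=
  submodule N /\ forall e v, N v -> N (hcomp e v).

End Shifts.
End HomogeneousComponents.

Section Generators.
Variables (K : fieldType) (n : nat).
Local Notation R := {mpoly K[n]}.

Lemma hcomp_lincomb r r' (s : 'I_r -> nat) (d : 'I_r' -> nat)
    (g : 'I_r' -> 'rV[R]_r) e (v : 'rV[R]_r') :
  (forall k, free_hom s (d k) (g k)) ->
  hcomp s e (\sum_k v 0 k *: g k) = \sum_k hcomp d e v 0 k *: g k.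
Proof.
move=> hg; rewrite hcomp_sum; apply: eq_bigr => k _.
by rewrite (hcomp_scale _ _ (hg k)) mxE; case: ifP; rewrite ?scale0r.
Qed.

Lemma hcomp_mulmx r r' (s : 'I_r -> nat) (d : 'I_r' -> nat)
    (G : 'M[R]_(r', r)) e (v : 'rV[R]_r') :
  (forall k, free_hom s (d k) (row k G)) ->
  hcomp s e (v *m G) = hcomp d e v *m G.
Proof. by move=> hG; rewrite !mulmx_sum_row (hcomp_lincomb e v hG). Qed.

Lemma least_nat (P : nat -> Prop) r0 : P r0 ->
  exists2 r, P r & forall q, P q -> (r <= q)%N.
Proof.
elim/ltn_ind: r0 => r IHr Pr.
have [[q Pq ltqr]|min_r] := classic (exists2 q, P q & (q < r)%N).
  exact: IHr Pq.
by exists r => // q Pq; rewrite leqNgt; apply/negP => ltqr; case: min_r; exists q.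
Qed.

(** The components of a finite generating system are homogeneous generators; a
    system of homogeneous generators of least cardinality is irredundant. *)
Lemma graded_minimal_gens r (s : 'I_r -> nat) (N : 'rV[R]_r -> Prop) :
  graded s N -> exists r' d (g : 'I_r' -> 'rV[R]_r),
    minimal_hom_gens (free_hom s) N d g.
Proof.
case=> subN hN; have [r0 [g0 gen0]] := noetherian subN.
pose P q := exists d (g : 'I_q -> 'rV[R]_r),
  generates N g /\ forall k, free_hom s (d k) (g k).
have [q0 Pq0] : exists q, P q.
  have /fin_all_exists[B_ hB] k := hcomp_partition s (g0 k).
  pose B := (\max_k B_ k)%N; pose J : finType := ('I_r0 * 'I_B)%type.
  pose h (y : J) := hcomp s y.2 (g0 y.1).
  have Ng0 k : N (g0 k).
    apply/gen0; exists (fun l => (l == k)%:R).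
    rewrite (bigD1 k) //= eqxx scale1r big1 ?addr0 // => l /negPf->.
    by rewrite scale0r.
  exists #|J|, (fun k : 'I_#|J| => (enum_val k).2 : nat), (fun k => h (enum_val k)).
  split=> [v|k]; last exact: hcompP.
  split=> [/gen0[c ->]|[c ->]]; last first.
    by apply: (submod_sum subN) => k _; apply/(submodZ subN)/hN.
  exists (fun k => c (enum_val k).1).
  transitivity (\sum_(y : J) c y.1 *: h y).
    rewrite -(pair_bigA _ (fun k e => c k *: h (k, e))) /=.
    apply: eq_bigr => k _; rewrite -scaler_sumr -hB //.
    exact: leq_bigmax.
  by rewrite -(big_enum_val (A := J) (fun y => c y.1 *: h y)); apply: eq_bigl.
have [q [d [g [gen hg]]] min_q] := least_nat Pq0.
exists q, d, g; split=> // k [c def_gk].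
have sum_lift (F : 'I_q -> 'rV[R]_r) :
    \sum_(l | l != k) F l = \sum_(j < q.-1) F (lift k j).
  apply: (addrI (F k)); rewrite -(bigD1_ord k (P := predT)) //.
  by rewrite [RHS](bigD1 k).
suff /min_q : P q.-1 by have := ltn_ord k; lia.
exists (fun j => d (lift k j)), (fun j => g (lift k j)); split=> // v.
split=> [/gen[a ->]|[a ->]].
  exists (fun j => a k * c (lift k j) + a (lift k j)).
  rewrite (bigD1 k) //= sum_lift {1}def_gk sum_lift scaler_sumr -big_split.
  by apply: eq_bigr => j _ /=; rewrite scalerDl scalerA.
apply: (submod_sum subN) => j _; apply: (submodZ subN); apply/gen.
exists (fun l => (l == lift k j)%:R).
rewrite (bigD1 (lift k j)) //= eqxx scale1r big1 ?addr0 // => l /negPf->.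
by rewrite scale0r.
Qed.

End Generators.

Section ResolutionExists.

Variables (K : fieldType) (n : nat).
Local Notation R := {mpoly K[n]}.

Record graded_module := GradedModule {
  gm_rank : nat;
  gm_deg : 'I_gm_rank -> nat;
  gm_sub : 'rV[R]_gm_rank -> Prop;
  gm_graded : graded gm_deg gm_sub
}.

Record generators (M : graded_module) := Generators {
  gen_rank : nat;
  gen_deg : 'I_gen_rank -> nat;
  gen_mx : 'M[R]_(gen_rank, gm_rank M);
  gen_min : minimal_hom_gens (free_hom (@gm_deg M)) (@gm_sub M) gen_deg
    (fun k => row k gen_mx)
}.

Lemma generators_exist M : inhabited (generators M).
Proof.
have [q [d [g min_g]]] := graded_minimal_gens (gm_graded M).
have def_g : g = fun k => row k (\matrix_k g k).
  by apply: functional_extensionality => k; rewrite rowK.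
by rewrite def_g in min_g; exists; apply: Generators min_g.
Qed.

(** The choice of generators for each syzygy module is made once and for all, so
    that the resolution is obtained by iteration. *)
Definition some_generators M := epsilon (generators_exist M) xpredT.

Lemma syzygy_graded M (G : generators M) :
  graded (@gen_deg M G) (fun v : 'rV[R]_(gen_rank G) => v *m gen_mx G = 0).
Proof.
have [_ _ hG] := gen_min G; split=> [|e v v0].
  split=> [|u v u0 v0|c v v0]; first exact: mul0mx.
    by rewrite mulmxDl u0 v0 addr0.
  by rewrite -scalemxAl v0 scaler0.
by rewrite -(hcomp_mulmx _ _ hG) v0 hcomp0.
Qed.

Definition syzygies M := GradedModule (syzygy_graded (some_generators M)).

Lemma minimal_resolution_exists (I : R -> Prop) :
  homogeneous_ideal I -> exists F, minimal_resolution I F.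
Proof.
move=> [[I0 ID IM] hI].
have grI : graded (fun _ : 'I_1 => 0%N) (fun v : 'rV[R]_1 => I (v 0 0)).
  split=> [|e v Iv]; last by rewrite mxE subn0; apply: hI.
  by split=> [|u v|c v]; rewrite mxE //; [apply: ID | apply: IM].
pose M j := iter j syzygies (GradedModule grI).
pose G j := some_generators (M j).
pose F := @Resolution K n (fun j => gen_rank (G j)) (fun j => @gen_deg _ (G j))
  (fun k => gen_mx (G 0%N) k ord0) (fun j => gen_mx (G j.+1)).
exists F; split=> [||j].
- have [gen irr hG] := gen_min (G 0%N); split=> [v|k [c def_gk]|k].
  + have := gen (\row_(_ < 1) v); rewrite /= mxE => ->; split=> -[c].
      move/rowP/(_ 0); rewrite mxE summxE => ->; exists c.
      by apply: eq_bigr => k _; rewrite !mxE.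
    move=> def_v; exists c; apply/rowP=> i; rewrite ord1 mxE summxE def_v.
    by apply: eq_bigr => k _; rewrite !mxE.
  + case: (irr k); exists c; apply/rowP=> i; rewrite ord1 mxE summxE.
    by rewrite [LHS]def_gk; apply: eq_bigr => l _; rewrite !mxE.
  + by have [] := hG k 0; rewrite /= subn0 mxE => + _; apply.
- have -> : (fun v : 'rV_(res_rank F 0) => \sum_k v 0 k * res_aug k = 0) =
            @gm_sub (M 1%N).
    apply: pred_ext => v /=; split=> [v0|/rowP/(_ 0)].
      by apply/rowP=> i; rewrite ord1 !mxE.
    by rewrite !mxE.
  exact: gen_min (G 1%N).
exact: gen_min (G j.+2).
Qed.

End ResolutionExists.

(** * The Koszul complex of the variables *)
Section PolynomialKoszul.

Variables (K : fieldType) (n : nat).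
Local Notation R := {mpoly K[n]}.

(** The variables as a sequence indexed by all natural numbers, as the Koszul
    complex expects. *)
Definition xvar (t : nat) : R := if insub t is Some i then 'X_(i : 'I_n) else 0.

Lemma xvarE (i : 'I_n) : xvar i = 'X_i.
Proof. by rewrite /xvar valK. Qed.

Lemma xvar_homog t : xvar t \is 1.-homog.
Proof.
rewrite /xvar; case: insubP => [i _ _|_]; last exact: dhomog0.
by rewrite dhomogX; apply/eqP; apply: mdeg1.
Qed.

Lemma kmx_homog i a b : kmx xvar n i a b \is 1.-homog.
Proof.
apply: (kmx_entry (P := fun c : R => c \is 1.-homog)) => [|t s _]; first exact: dhomog0.
by rewrite -signr_odd; case: odd; rewrite ?expr1 ?expr0 ?mul1r ?mulN1r ?dhomogN;
  apply: xvar_homog.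
Qed.

(** Membership in the ideal generated by the first t variables, read off the
    monomials. *)
Definition vars_below t (p : R) : Prop :=
  forall mu, mu \in msupp p -> exists2 i : 'I_n, (i < t)%N & (0 < mu i)%N.

Lemma vars_below_submod t : @submodule R R^o (vars_below t).
Proof.
split=> [mu|p q hp hq mu|c p hp mu]; first by rewrite msupp0.
  by move/msuppD_le; rewrite mem_cat => /orP[/hp|/hq].
case/msuppM_le/allpairsP=> -[m1 m2] /= [_ /hp[i lti gt0] ->].
by exists i; rewrite // mnmDE ltn_addl.
Qed.

Definition in_kmx0 t (p : R) : Prop :=
  exists c : 'cV[R]_(krank t 1), forall a, (kmx xvar t 0 *m c) a 0 = p.

Lemma in_kmx0_submod t : @submodule R R^o (in_kmx0 t).
Proof.
split=> [|p q [c hc] [c' hc']|a p [c hc]].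
- by exists 0 => a; rewrite mulmx0 mxE.
- by exists (c + c') => a; rewrite mulmxDr mxE hc hc'.
- by exists (a *: c) => b; rewrite -scalemxAr mxE hc.
Qed.

Lemma in_kmx0_mulX t (i : 'I_n) q : (i < t)%N -> in_kmx0 t (q * 'X_i).
Proof.
elim: t => // t IHt; rewrite ltnS leq_eqVlt => /orP[/eqP def_t|/IHt[c hc]].
  exists (col_mx 0 (const_mx q)) => a /=.
  by rewrite mul_row_col mulmx0 add0r mul_scalar_mx !mxE -def_t xvarE mulrC.
by exists (col_mx c 0) => a /=; rewrite mul_row_col mulmx0 addr0.
Qed.

Lemma in_kmx0P t p : vars_below t p <-> in_kmx0 t p.
Proof.
split=> [hp|[c hc]].
  rewrite [p]mpolyE big_seq; apply: (big_ind (in_kmx0 t)).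
  - exact: (submod0 (in_kmx0_submod t)).
  - exact: (submodD (in_kmx0_submod t)).
  move=> mu /hp[i lti mu_i]; rewrite -mul_mpolyC.
  have -> : mu = (mu - U_(i) + U_(i))%MM.
    rewrite submK //; apply/mnm_lepP=> j; rewrite mnm1E.
    by case: eqP => // <-.
  by rewrite mpolyXD mulrA; apply: in_kmx0_mulX.
have [a0 _] := krank0_single t.
rewrite -(hc a0) mxE; apply: (submod_sum (vars_below_submod t)) => b _.
rewrite mulrC; apply: (submodZ (vars_below_submod t)).
apply: (kmx_entry (P := vars_below t)) => [|t' s lt_t']; first exact: (submod0 (vars_below_submod t)).
apply: (submodZ (vars_below_submod t)) => mu.
rewrite /xvar; case: insubP => [i _ def_i|_]; last by rewrite msupp0.
by rewrite msuppX inE => /eqP->; exists i; rewrite ?def_i // mnm1E eqxx.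
Qed.

Lemma kexact_ring : kexact xvar n R^o.
Proof.
apply: kexact_regular => t b c ltn def_xb.
pose i := Ordinal ltn.
have [a0 all_a] := krank0_single t.
have /in_kmx0P/(_ _)xb : in_kmx0 t (xvar t * b a0 0).
  by exists c => a; rewrite -def_xb mxE (all_a a).
have /in_kmx0P[c' hc'] : vars_below t (b a0 0).
  move=> mu mu_b; have [|j ltj] := xb (mu + U_(i))%MM.
    rewrite (xvarE i) mcoeff_msupp mulrC addmC mcoeffMX -mcoeff_msupp //.
  rewrite mnmDE mnm1E; case: eqP => [def_i|_]; last by rewrite addn0; exists j.
  by rewrite -def_i ltnn in ltj.
by exists c'; apply/matrixP=> a z; rewrite ord1 hc' (all_a a).
Qed.

Lemma vars_below_const p : vars_below n p <-> p@_0 = 0.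
Proof.
split=> [hp|p0 mu mu_p].
  apply: memN_msupp_eq0; apply/negP => /hp[i _]; by rewrite mnm0E.
case: (pickP [pred i : 'I_n | 0 < mu i]%N) => [i gt0|mu0]; first by exists i.
have def_mu : mu = 0%MM.
  by apply/mnmP=> i; rewrite mnm0E; have /= := mu0 i; lia.
by move: mu_p; rewrite def_mu mcoeff_msupp p0 eqxx.
Qed.

End PolynomialKoszul.

(** * Degrees of minimal generators of syzygies *)
Section GradedKoszul.

Variables (K : fieldType) (n : nat).
Local Notation R := {mpoly K[n]}.
Local Notation x := (xvar K n).
Local Notation D := (kmx x n).

(** The Koszul homology of degree i is not zero at chains whose entries have
    degree e.  As the i-th Koszul module is generated in degree i, this is the
    internal degree e + i. *)
Definition khomology_deg_neq0 (V : lmodType R) (hom : nat -> V -> Prop)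
    (N : V -> Prop) i e :=
  exists z : 'I_(krank n i) -> V,
    [/\ kcycle x N z, forall a, hom e (z a) & ~ kboundary x N z].

Lemma mcoeff_pihomog N (mf : measure N) d (p : {mpoly K[N]}) mu :
  (pihomog mf d p)@_mu = if mf mu == d then p@_mu else 0.
Proof.
rewrite pihomogE raddf_sum big_mkcond /=.
have [mu_p|mu_p] := boolP (mu \in msupp p).
  rewrite (bigD1_seq mu) ?msupp_uniq //= big1 ?addr0 => [|m ne_m].
    by case: ifP; rewrite // mcoeffZ mcoeffX eqxx mulr1.
  by rewrite mcoeffZ mcoeffX (negPf ne_m) mulr0 if_same.
rewrite (memN_msupp_eq0 mu_p) if_same big_seq big1 // => m m_p.
rewrite mcoeffZ mcoeffX; case: (eqVneq m mu) => [def_m|_].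
  by rewrite -def_m m_p in mu_p.
by rewrite mulr0 if_same.
Qed.

Section OneStep.

Variables (r r' : nat) (s : 'I_r -> nat) (d : 'I_r' -> nat).
Variables (N : 'rV[R]_r -> Prop) (G : 'M[R]_(r', r)).
Hypothesis minG : minimal_hom_gens (free_hom s) N d (fun k => row k G).
Local Notation ker := (fun v : 'rV[R]_r' => v *m G = 0).

Lemma rows_hom k : free_hom s (d k) (row k G).
Proof. by case: minG. Qed.

Lemma span_rows : N = fun w => exists v : 'rV_r', v *m G = w.
Proof.
apply: pred_ext => w; case: minG => gen _ _; split=> [/gen[c ->]|[v <-]].
  exists (\row_k c k); rewrite mulmx_sum_row.
  by apply: eq_bigr => k _; rewrite mxE.
by apply/gen; exists (v 0); rewrite mulmx_sum_row.
Qed.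

Lemma hcomp_mact m p q (t : 'I_m -> nat) (A : 'M[R]_(p, q)) (y : 'I_q -> 'rV[R]_m) e a :
  (forall a b, A a b \is 1.-homog) ->
  hcomp t e (mact A y a) =
    if e is e'.+1 then mact A (fun b => hcomp t e' (y b)) a else 0.
Proof.
move=> hA; rewrite hcomp_sum; case: e => [|e].
  by apply: big1 => b _; rewrite (hcomp_mul _ _ _ (hA a b)).
by apply: eq_bigr => b _; rewrite (hcomp_mul _ _ _ (hA a b)) subn1.
Qed.

(** Minimality: a constant term in the k-th coordinate of a syzygy, read in
    degree [d k], would express the k-th generator by the others. *)
Lemma syzygy_const (v : 'rV[R]_r') k : v *m G = 0 -> (v 0 k)@_0 = 0.
Proof.
move=> vG0; apply/eqP/negP => /negP v0; case: minG => _ irr _; apply: (irr k).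
have hv : hcomp d (d k) v *m G = 0.
  by rewrite -(hcomp_mulmx _ _ rows_hom) vG0 hcomp0.
pose c := ((v 0 k)@_0)^-1.
exists (fun l => - c%:MP * hcomp d (d k) v 0 l).
have vkE : hcomp d (d k) v 0 k = ((v 0 k)@_0)%:MP.
  rewrite mxE leqnn subnn; apply/mpolyP => mu; rewrite mcoeffC mcoeff_pihomog.
  by rewrite mdeg_eq0 eq_sym; case: eqP => [->|_]; rewrite ?mulr1 ?mulr0.
move: hv; rewrite mulmx_sum_row (bigD1 k) //= vkE => /eqP.
rewrite addr_eq0 => /eqP hv.
have -> : row k G = c%:MP *: (((v 0 k)@_0)%:MP *: row k G).
  by rewrite scalerA -mpolyCM mulVf // scale1r.
rewrite hv scalerN scaler_sumr -sumrN; apply: eq_bigr => l _.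
by rewrite scalerA mulNr scaleNr.
Qed.

Lemma syzygy_boundary (v : 'rV[R]_r') : (forall k, (v 0 k)@_0 = 0) ->
  exists y : 'I_(krank n 1) -> 'rV_r', forall a, mact (D 0) y a = v.
Proof.
move=> v0; have /fin_all_exists[c hc] k : in_kmx0 n (v 0 k).
  by apply/in_kmx0P/vars_below_const.
exists (fun b => \row_k c k b 0) => a; apply/rowP=> k.
rewrite -(hc k a) summxE mxE; apply: eq_bigr => b _.
by rewrite !mxE.
Qed.

Lemma syzygy_cycle_lift i (w : 'I_(krank n i) -> 'rV[R]_r') :
  kcycle x ker w -> exists y, forall a, mact (D i) y a = w a.
Proof.
case: i w => [|i] w [kerw cw]; last exact: (kexact_row (@kexact_ring K n)).
have [a0 all_a] := krank0_single n.
have [y def_y] := syzygy_boundary (fun k => syzygy_const k (kerw a0)).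
by exists y => a; rewrite def_y (all_a a).
Qed.

(** Dimension shifting in the graded setting.  Lifting through [G] preserves the
    degree of the entries, and the Koszul differential raises it by one. *)
Lemma khomology_deg_shift i e :
  khomology_deg_neq0 (free_hom s) N i.+1 e <->
  khomology_deg_neq0 (free_hom d) ker i e.+1.
Proof.
have exV : kexact x n 'rV[R]_r' by apply/kexact_row/kexact_ring.
have kerE : (fun v => mulmxr G v = 0) = ker by [].
rewrite span_rows; split=> [[z [cz hz nbz]]|[w [cw hw nbw]]].
  have [/fin_all_exists[y0 def_z] _] := cz.
  (* the degree e part of a lift is still a lift *)
  pose y a := hcomp d e (y0 a).
  have {}def_z : z = mulmxr G \o y.
    apply: functional_extensionality => a.
    by rewrite /= -(hcomp_mulmx _ _ rows_hom) def_z hcomp_id.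
  exists (mact (D i) y); split.
  - by rewrite -kerE; apply/shift_cycle; rewrite -def_z.
  - move=> a; have <- : hcomp d e.+1 (mact (D i) y0 a) = mact (D i) y a.
      by rewrite hcomp_mact //; apply: kmx_homog.
    exact: hcompP.
  - by rewrite -kerE => /(shift_boundary (mulmxr G) exV); rewrite -def_z.
have [y0 def_w] := syzygy_cycle_lift cw.
pose y a := hcomp d e (y0 a).
have {}def_w : mact (D i) y = w.
  apply: functional_extensionality => a; rewrite -[RHS](hcomp_id (hw a)).
  by rewrite -def_w hcomp_mact //; apply: kmx_homog.
rewrite -def_w in cw nbw.
exists (mulmxr G \o y); split.
- exact: (shift_cycle _ (mulmxr G) y).2 cw.
- move=> a /=; rewrite -(hcomp_mulmx _ _ rows_hom); exact: hcompP.
- by move/(shift_boundary (mulmxr G) exV).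
Qed.

(** Syzygies of a minimal system are boundaries of chains over the free module,
    and boundaries have entries of positive degree. *)
Lemma khomology_deg0 i : ~ khomology_deg_neq0 (free_hom d) ker i 0.
Proof.
case=> w [cw hw]; case.
have [y0 def_w] := syzygy_cycle_lift cw.
exists (fun=> 0); split=> [b|a]; first by rewrite mul0mx.
by rewrite mact0 // -[RHS](hcomp_id (hw a)) -def_w hcomp_mact //; apply: kmx_homog.
Qed.

(** A graded form of Nakayama's lemma: H_0 is the quotient by the irrelevant ideal,
    and it has a basis formed by the minimal generators. *)
Lemma khomology0_gens e :
  khomology_deg_neq0 (free_hom s) N 0 e <-> exists k, d k = e.
Proof.
case: minG => gen irr _; split=> [[z [[Nz _] hz nbz]]|[k <-]].
  apply: NNPP => no_k; apply: nbz.
  have [a0 all_a] := krank0_single n.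
  move: (Nz a0); rewrite span_rows => -[v0 def_z].
  pose v := hcomp d e v0.
  have {}def_z : v *m G = z a0.
    by rewrite -(hcomp_mulmx _ _ rows_hom) def_z hcomp_id.
  have [k|y def_v] := @syzygy_boundary v.
    rewrite mxE; case: ifP => [le_d|_]; last by rewrite mcoeff0.
    rewrite mcoeff_pihomog; case: eqP => // def_e; case: no_k; exists k.
    by move: def_e le_d; rewrite [LHS]mdeg0; lia.
  exists (fun b => y b *m G); split=> [b|a]; first by exists (y b).
  by rewrite (all_a a) -def_z -(def_v a0) -[RHS]/(mulmxr G _) mact_linear.
exists (fun=> row k G); split=> [|a|[w [Nw def_k]]].
- by split=> // a; rewrite span_rows; exists (delta_mx 0 k); rewrite -rowE.
- exact: rows_hom.
apply: (irr k).
have [a0 _] := krank0_single n.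
move: Nw; rewrite span_rows => /fin_all_exists[c def_w].
pose q : 'rV[R]_r' := mact (D 0) c a0.
have def_gk : row k G = hcomp d (d k) q *m G.
  rewrite -(hcomp_mulmx _ _ rows_hom) -[q *m G]/(mulmxr G q) mact_linear.
  rewrite (mact_ext _ def_w) def_k hcomp_id //; exact: rows_hom.
exists (fun l => hcomp d (d k) q 0 l).
rewrite {1}def_gk mulmx_sum_row (bigD1 k) //=.
suff -> : hcomp d (d k) q 0 k = 0 by rewrite scale0r add0r.
rewrite hcomp_mact; last exact: kmx_homog.
case def_e: (d k) => [|e']; first by rewrite mxE.
rewrite summxE big1 // => b _; rewrite !mxE def_e ltnn mulr0 //.
Qed.

End OneStep.
End GradedKoszul.

(** * The degrees [tdeg] as degrees of Koszul homology *)
Section ResolutionHomology.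

Variables (K : fieldType) (n : nat).
Local Notation R := {mpoly K[n]}.
Local Notation x := (xvar K n).

(** A resolution with its augmentation, seen as one sequence of graded free
    modules whose term of index 0 is the ring itself. *)
Section Chain.

Variables (I : R -> Prop) (F : resolution K n).

Definition chain_rank j := if j is j'.+1 then res_rank F j' else 1%N.

Definition chain_deg j : 'I_(chain_rank j) -> nat :=
  match j with 0 => fun=> 0%N | j'.+1 => @res_deg _ _ F j' end.

Definition chain_map j : 'M[R]_(chain_rank j.+1, chain_rank j) :=
  match j with 0 => \matrix_(k, _) res_aug k | j'.+1 => res_map F j' end.

Definition chain_syzygy j : 'rV[R]_(chain_rank j) -> Prop :=
  match j with
  | 0 => fun v => I (v 0 0)
  | j'.+1 => fun v => v *m chain_map j' = 0
  end.

Hypothesis minF : minimal_resolution I F.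

Lemma chain_minimal j :
  minimal_hom_gens (free_hom (@chain_deg j)) (@chain_syzygy j)
    (@chain_deg j.+1) (fun k => row k (chain_map j)).
Proof.
case: minF => min0 min1 min2; case: j => [|[|j]]; last exact: min2.
  case: min0 => gen irr hom; split=> [v|k [c def_k]|k i] /=.
  - rewrite (gen (v 0 0)); split=> -[c def_v]; exists c.
      apply/rowP=> i; rewrite ord1 summxE def_v.
      by apply: eq_bigr => k _; rewrite !mxE.
    rewrite def_v summxE; apply: eq_bigr => k _.
    by rewrite !mxE.
  - case: (irr k); exists c; move/rowP/(_ 0): def_k.
    by rewrite !mxE summxE => ->; apply: eq_bigr => l _; rewrite !mxE.
  - by rewrite !mxE subn0; split=> // _; apply: hom.
rewrite [X in minimal_hom_gens _ X](_ : _ = (fun v : 'rV_(res_rank F 0) =>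
  \sum_k v 0 k * @res_aug _ _ F k = 0)) //.
apply: pred_ext => v /=; split=> [/rowP/(_ 0)|v0].
  by rewrite !mxE => {2}<-; apply: eq_bigr => k _; rewrite mxE.
by apply/rowP=> i; rewrite !mxE -{2}v0; apply: eq_bigr => k _; rewrite mxE.
Qed.

Lemma res_deg_homology j e : (exists k, @res_deg _ _ F j k = e) <->
  exists2 eps, e = (eps + j)%N &
    khomology_deg_neq0 (free_hom (@chain_deg 0)) (@chain_syzygy 0) j eps.
Proof.
rewrite -(khomology0_gens (chain_minimal j)).
pose P i l := exists2 eps, e = (eps + l)%N &
  khomology_deg_neq0 (free_hom (@chain_deg i)) (@chain_syzygy i) l eps.
have step i l : P i l.+1 <-> P i.+1 l.
  split=> [[eps def_e]|[[|eps] def_e]].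
  - move/(khomology_deg_shift (chain_minimal i)) => nz.
    by exists eps.+1; rewrite // def_e addnS.
  - by move/(khomology_deg0 (chain_minimal i)).
  - move/(khomology_deg_shift (chain_minimal i)) => nz.
    by exists eps; rewrite // def_e addnS.
have all i l : P i l <-> P (i + l)%N 0%N.
  elim: l i => [|l IHl] i; first by rewrite addn0.
  by rewrite step IHl addSnnS.
apply: iff_trans (iff_sym (all 0%N j)); rewrite add0n; split=> [nz|[eps -> nz]].
  by exists e; rewrite ?addn0.
by rewrite addn0.
Qed.

End Chain.

(** As for [khomology_deg_neq0], e is the degree of the entries, so that the
    internal degree is e + j. *)
Definition ideal_homology_neq0 (I : R -> Prop) j e :=
  @khomology_deg_neq0 K n R^o (@poly_hom K n) I j e.

Lemma row_homology (I : R -> Prop) j e :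
  khomology_deg_neq0 (free_hom (fun _ : 'I_1 => 0%N))
    (fun v : 'rV[R]_1 => I (v 0 0)) j e <-> ideal_homology_neq0 I j e.
Proof.
have actE p q (A : 'M[R]_(p, q)) (w : 'I_q -> 'rV[R]_1) a :
    mact A w a 0 0 = mact A (fun b => w b 0 0 : R^o) a.
  by rewrite summxE; apply: eq_bigr => b _; rewrite mxE.
have row1 (u v : 'rV[R]_1) : u 0 0 = v 0 0 -> u = v.
  by move=> eq_uv; apply/rowP=> i; rewrite ord1.
split=> [[z [[Iz cz] hz nbz]]|[z [[Iz cz] hz nbz]]].
  exists (fun a => z a 0 0); split.
  - split=> //; case: j z cz {Iz hz nbz} => // j z cz a.
    by rewrite -actE cz mxE.
  - by move=> a; have [+ _] := hz a 0; rewrite subn0; apply.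
  case=> w [Iw def_z]; apply: nbz; exists (fun b => \row_(_ < 1) w b).
  split=> [b|a]; first by rewrite mxE.
  apply: row1; rewrite actE -def_z; apply: eq_bigr => b _.
  by rewrite mxE.
exists (fun a => \row_(_ < 1) z a); split.
- split=> [a|]; first by rewrite mxE.
  case: j z cz {Iz hz nbz} => // j z cz a; apply: row1.
  by rewrite actE mxE -[RHS](cz a); apply: eq_bigr => b _; rewrite mxE.
- by move=> a i; rewrite mxE subn0; split=> // _; apply: hz.
case=> w [Iw def_z]; apply: nbz; exists (fun b => w b 0 0); split=> // a.
by rewrite -actE def_z mxE.
Qed.

Lemma res_deg_ideal_homology I F j e : minimal_resolution I F ->
  (exists k, @res_deg _ _ F j k = e) <->
  exists2 eps, e = (eps + j)%N & ideal_homology_neq0 I j eps.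
Proof.
move=> minF; apply: iff_trans (res_deg_homology minF _ _) _.
by split=> -[eps -> /row_homology nz]; exists eps.
Qed.

(** For j = n this is torsion-freeness, and there are no chains for j > n. *)
Lemma ideal_homology_top I j e : (0 < n)%N -> @submodule R R^o I ->
  (n <= j)%N -> ~ ideal_homology_neq0 I j e.
Proof.
move=> n_gt0 subI le_nj [z [cz _]]; case; exists (fun=> 0).
split=> [b|a]; first exact: (submod0 subI).
rewrite mact0 //; move: le_nj; rewrite leq_eqVlt => /orP[/eqP def_j|ltnj].
  subst j; apply/esym/(kcycle_top subI n_gt0 _ cz) => v.
  rewrite (xvarE K (Ordinal n_gt0)) => /eqP.
  rewrite mulf_eq0 -msupp_eq0 msuppX /= => /eqP //.
by have := ltn_ord a; rewrite [X in (_ < X)%N]krank_top.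
Qed.

(** Any minimal resolution has its degrees in [res_deg_ideal_homology], hence so
    does the one picked by [epsilon] in [tdeg]. *)
Lemma tdeg_eq_max I j b (L : 'I_b -> int) : homogeneous_ideal I ->
  (forall e, ideal_homology_neq0 I j e -> exists k, ((e + j)%N%:Z <= L k)%R) ->
  (forall k, exists2 e, ideal_homology_neq0 I j e & (e + j)%N%:Z = L k) ->
  tdeg j I = \big[Order.max/@ENInf int]_(k < b) EFin (L k).
Proof.
move=> homI upL atL.
have [F minF ->] : exists2 F, minimal_resolution I F & tdeg j I = res_top F j.
  apply: (@epsilon_spec _ (inhabits (@ENInf int)) (fun t =>
    exists2 F, minimal_resolution I F & t = res_top F j)).
  by have [F minF] := minimal_resolution_exists homI; exists (res_top F j), F.
have degE := res_deg_ideal_homology j _ minF.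
apply/le_anti/andP; split; apply: bigmax_le => [|k _].
- by rewrite leNye.
- have [eps def_e /upL[l le_l]] := (degE (res_deg k)).1 (ex_intro _ k erefl).
  apply: le_trans (le_bigmax _ _ l).
  by rewrite lee_fin def_e.
- by rewrite leNye.
have [e nz <-] := atL k.
have [|l <-] := (degE (e + j)%N).2; first by exists e.
exact: (le_bigmax _ (fun k => EFin (res_deg k)%:Z) l).
Qed.

End ResolutionHomology.

(** * Projective dimension *)
Section ProjectiveDimension.

Section FreeModule.
Variables (R : comNzRingType) (r : nat) (V : lmodType R).

Definition row_comb (a : 'I_r -> V) (v : 'rV[R]_r) : V := \sum_k v 0 k *: a k.

Lemma row_comb_is_linear a : linear (row_comb a).
Proof.
move=> c u v; rewrite scaler_sumr -big_split; apply: eq_bigr => k _.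
by rewrite !mxE scalerDl scalerA.
Qed.
HB.instance Definition _ a :=
  GRing.isLinear.Build R 'rV[R]_r V *:%R (row_comb a) (row_comb_is_linear a).

End FreeModule.

Lemma projective_row (R : comNzRingType) r : projective 'rV[R]_r.
Proof.
move=> A B g f surj_g.
have /fin_all_exists[a ga] (k : 'I_r) := surj_g (f (delta_mx 0 k)).
exists (row_comb a) => v; rewrite /= linear_sum [v in RHS]row_sum_delta linear_sum.
by apply: eq_bigr => k _; rewrite !linearZ ga.
Qed.

Variables (K : fieldType) (n : nat).
Local Notation R := {mpoly K[n]}.

Lemma minimal_resolution_projective (I : R -> Prop) F p :
  minimal_resolution I F -> (forall j, (p < j)%N -> res_rank F j = 0%N) ->
  @has_projective_resolution R R^o I p.
Proof.
case=> [[gen0 _ _] [gen1 _ _] gens] F0.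
have gen_mul r q (N : 'rV[R]_q -> Prop) (G : 'M[R]_(r, q)) v :
    generates N (fun k => row k G) -> N v <-> exists y, mulmxr G y = v.
  move=> gen; split=> [/gen[c ->]|[y <-]].
    exists (\row_k c k); rewrite /= mulmx_sum_row.
    by apply: eq_bigr => k _; rewrite mxE.
  by apply/gen; exists (y 0); rewrite /= mulmx_sum_row.
exists (fun j => 'rV[R]_(res_rank F j)), (fun j => mulmxr (res_map F j)).
exists (@row_comb R _ R^o (@res_aug _ _ F)); split; first by move=> i; apply: projective_row.
split=> [v|].
  split=> [/gen0[c ->]|[y <-]]; last by apply/gen0; exists (y 0).
  by exists (\row_k c k); apply: eq_bigr => k _; rewrite mxE.
split=> [y|]; first exact: (gen_mul _ _ _ _ y gen1).
split=> [i y|i /F0 r0 y].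
  by have [gen _ _] := gens i; apply: (gen_mul _ _ _ _ y gen).
by apply/rowP=> k; have := ltn_ord k; rewrite [X in (_ < X)%N]r0.
Qed.

Lemma ideal_is_pd (I : R -> Prop) p : homogeneous_ideal I ->
  (forall j e, (p < j)%N -> ~ ideal_homology_neq0 I j e) ->
  (p = 0%N \/ exists e, ideal_homology_neq0 I p e) ->
  @is_pd R R^o I p.
Proof.
move=> homI vanish top; have [F minF] := minimal_resolution_exists homI.
split.
  apply: (minimal_resolution_projective minF) => j ltpj.
  apply/eqP; rewrite -leqn0 leqNgt; apply/negP => rank_gt0.
  have [e _ nz] := (res_deg_ideal_homology j _ minF).1
    (ex_intro _ (Ordinal rank_gt0) erefl).
  exact: vanish nz.
move=> q; case: top => [-> //|[e [z [cz _ nbz]]] resI].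
rewrite leqNgt; apply/negP => ltqp.
by case: (khomology_projective_resolution (@kexact_ring K n) resI ltqp); exists z.
Qed.

End ProjectiveDimension.

(** * Products of ideals as images of multigraded polynomials *)

(** The variables of S = K[N] are specialized by [img].  The uncoloured ones are the
    variables of R; the coloured ones stand for generators of ideals, one colour
    for each ideal. *)
Section Rees.

Variables (K : fieldType) (n N m : nat).
Local Notation R := {mpoly K[n]}.
Local Notation S := {mpoly K[N]}.

Variables (img : 'I_N -> R) (delta : 'I_N -> nat) (color : 'I_N -> option 'I_m).
Hypothesis img_homog : forall v, img v \is (delta v).-homog.
Hypothesis none_var : forall t : 'I_n, exists v, color v = None /\ img v = 'X_t.

Implicit Types (a b : 'I_m -> nat) (s : S) (mu : 'X_{1..N}).

Definition wt mu := weight delta mu.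
Definition md mu : 'I_m -> nat := multideg color mu.

Lemma wt0 : wt 0%MM = 0%N.
Proof. by apply: big1 => v _; rewrite mnm0E muln0. Qed.

Lemma wtD mu nu : wt (mu + nu)%MM = (wt mu + wt nu)%N.
Proof. by rewrite -big_split; apply: eq_bigr => v _; rewrite mnmDE mulnDr. Qed.

HB.instance Definition _ := isMeasure.Build N wt wt0 wtD.

Lemma md0 : md 0%MM =1 fun=> 0%N.
Proof. by move=> i; apply: big1 => v _; rewrite mnm0E. Qed.

Lemma mdD mu nu : md (mu + nu)%MM =1 fun i => (md mu i + md nu i)%N.
Proof. by move=> i; rewrite -big_split; apply: eq_bigr => v _; rewrite mnmDE. Qed.

Lemma md1 v i : md U_(v)%MM i = (color v == Some i).
Proof.
rewrite /md /multideg; have [cv|ncv] := boolP (color v == Some i).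
  rewrite (bigD1 v) //= mnm1E eqxx big1 // => w /andP[_ ne_wv].
  by rewrite mnm1E eq_sym (negPf ne_wv).
apply: big1 => w cw; rewrite mnm1E; case: eqP => // def_v.
by rewrite def_v cw in ncv.
Qed.

Definition ev : S -> R := mmap (@mpolyC n K) img.
HB.instance Definition _ := GRing.RMorphism.copy ev (mmap (@mpolyC n K) img).

Lemma evC c : ev c%:MP = c%:MP. Proof. exact: mmapC. Qed.
Lemma evX v : ev 'X_v = img v. Proof. by rewrite /ev mmapX mmap1U. Qed.
Lemma evZ c s : ev (c *: s) = c *: ev s.
Proof. by rewrite -!mul_mpolyC rmorphM /= evC. Qed.

Lemma ev_mnm_homog mu : ev 'X_[mu] \is (wt mu).-homog.
Proof.
rewrite mpolyXE_id rmorph_prod /=; pose P d (p : R) := p \is d.-homog.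
rewrite /wt /weight; apply: (big_ind2 (fun p d => P d p)).
- exact: dhomog1.
- by move=> p d q e hp hq; apply: dhomogM.
by move=> v _; rewrite rmorphXn /= evX; apply: dhomogMn.
Qed.

Lemma ev_homog s e : (forall mu, mu \in msupp s -> wt mu = e) ->
  ev s \is e.-homog.
Proof.
move=> hs; rewrite [s]mpolyE rmorph_sum big_seq /=.
apply: rpred_sum => mu /hs def_e; rewrite evZ; apply: dhomogZ.
by rewrite -def_e; apply: ev_mnm_homog.
Qed.

Lemma ev_component e s : ev (pihomog wt e s) = pihomog mdeg e (ev s).
Proof.
rewrite pihomogE [s in RHS]mpolyE !rmorph_sum raddf_sum big_mkcond /=.
apply: eq_bigr => mu _; rewrite !evZ linearZ /=.
have hmu := ev_mnm_homog mu.
case: eqP => [<-|/eqP ne_e]; first by rewrite pihomog_dE.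
by rewrite (pihomog_ne0 ne_e hmu) scaler0.
Qed.

Definition of_multideg a s := forall mu, mu \in msupp s -> md mu =1 a.

Lemma of_multideg0 a : of_multideg a 0.
Proof. by move=> mu; rewrite msupp0. Qed.

Lemma of_multidegD a s s' :
  of_multideg a s -> of_multideg a s' -> of_multideg a (s + s').
Proof.
by move=> hs hs' mu /msuppD_le; rewrite mem_cat => /orP[/hs|/hs'].
Qed.

Lemma of_multidegM a b s s' : of_multideg a s -> of_multideg b s' ->
  of_multideg (fun i => (a i + b i)%N) (s * s').
Proof.
move=> hs hs' mu /msuppM_le/allpairsP[[m1 m2] /= [/hs h1 /hs' h2 ->]] i.
by rewrite mdD h1 h2.
Qed.

(** The coefficient of t^a in the multi-Rees algebra: the image of the
    polynomials of multidegree a. *)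
Definition rees a (p : R) := exists2 s, of_multideg a s & ev s = p.

Lemma rees_ext a b p : a =1 b -> rees a p -> rees b p.
Proof. by move=> eq_ab [s hs <-]; exists s => // mu /hs h i; rewrite h eq_ab. Qed.

Lemma reesM a b p q : rees a p -> rees b q ->
  rees (fun i => (a i + b i)%N) (p * q).
Proof.
move=> [s hs <-] [s' hs' <-]; exists (s * s'); first exact: of_multidegM.
by rewrite rmorphM.
Qed.

Lemma reesD a p q : rees a p -> rees a q -> rees a (p + q).
Proof.
move=> [s hs <-] [s' hs' <-]; exists (s + s'); first exact: of_multidegD.
by rewrite rmorphD.
Qed.

Lemma rees0 a : rees a 0.
Proof. by exists 0; [apply: of_multideg0 | rewrite rmorph0]. Qed.

Lemma rees_img v : rees (fun i => (color v == Some i : nat)) (img v).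
Proof.
exists 'X_v; last exact: evX.
by move=> mu; rewrite msuppX inE => /eqP-> i; rewrite md1.
Qed.

Lemma rees_scalar p : rees (fun=> 0%N) p.
Proof.
have rM q q' : rees (fun=> 0%N) q -> rees (fun=> 0%N) q' -> rees (fun=> 0%N) (q * q').
  by move=> hq hq'; apply: rees_ext (reesM hq hq').
have rC c : rees (fun=> 0%N) c%:MP.
  exists c%:MP; last exact: evC.
  by move=> mu; rewrite msuppC; case: eqP => // _; rewrite inE => /eqP->; apply: md0.
rewrite [p]mpolyE; apply: (big_ind (rees _)) => [||mu _].
- exact: rees0.
- by move=> q q'; apply: reesD.
rewrite -mul_mpolyC; apply: (rM) => //; rewrite mpolyXE_id.
apply: (big_ind (rees _)) => [||t _]; first exact: (rC 1).
  exact: (rM).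
elim: (mu t) => [|k IHk]; first exact: (rC 1).
rewrite exprS; apply: (rM) => //; have [v [cv <-]] := none_var t.
by apply: rees_ext (rees_img v) => i; rewrite cv.
Qed.

Lemma rees_ideal a : is_ideal (rees a).
Proof.
split; [exact: rees0|by move=> p q; apply: reesD|move=> c p hp].
exact: rees_ext (reesM (rees_scalar c) hp).
Qed.

(** Homogeneous elements lift to elements homogeneous for the weight as well,
    since the specialization maps weight to degree. *)
Lemma rees_component a e p : rees a p ->
  exists2 s, of_multideg a s /\ (forall mu, mu \in msupp s -> wt mu = e) &
    ev s = pihomog mdeg e p.
Proof.
case=> s hs <-; exists (pihomog wt e s); last exact: ev_component.
split=> mu; rewrite mcoeff_msupp mcoeff_pihomog; case: ifP => [/eqP def_e|_].
- by rewrite -mcoeff_msupp; apply: hs.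
- by rewrite eqxx.
- by [].
- by rewrite eqxx.
Qed.

Lemma rees_homogeneous a : homogeneous_ideal (rees a).
Proof.
split=> [|p e /(rees_component e)[s [hs _] def_s]]; first exact: rees_ideal.
by exists s.
Qed.

Lemma rees_submodule a : @submodule R R^o (rees a).
Proof. by have [] := rees_ideal a. Qed.

End Rees.

(** ** Products and powers of ideals *)
Section IdealProducts.

Variable R : comNzRingType.
Implicit Types I J : R -> Prop.

Lemma ideal_one_ideal : is_ideal (@ideal_one R).
Proof. by []. Qed.

Lemma ideal_mul_ideal I J : is_ideal I -> is_ideal J -> is_ideal (ideal_mul I J).
Proof.
move=> [I0 ID IM] [J0 JD JM]; split=> [|x y|c x].
- by exists 0%N, (fun=> 0), (fun=> 0); split=> //; rewrite big_ord0.
- move=> [r [u [v [Iu Jv ->]]]] [r' [u' [v' [Iu' Jv' ->]]]].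
  exists (r + r')%N.
  exists (fun k => match split k with inl i => u i | inr j => u' j end).
  exists (fun k => match split k with inl i => v i | inr j => v' j end).
  split=> [k|k|]; [by case: split | by case: split |].
  rewrite big_split_ord /=; congr (_ + _); apply: eq_bigr => k _.
    by rewrite (unsplitK (inl k)).
  by rewrite (unsplitK (inr k)).
move=> [r [u [v [Iu Jv ->]]]]; exists r, (fun k => c * u k), v; split=> // [k|].
  exact: IM.
by rewrite mulr_sumr; apply: eq_bigr => k _; rewrite mulrA.
Qed.

Lemma ideal_mul_in I J x y : I x -> J y -> ideal_mul I J (x * y).
Proof.
by move=> Ix Jy; exists 1%N, (fun=> x), (fun=> y); split=> //; rewrite big_ord1.
Qed.

Lemma ideal_exp_ideal I a : is_ideal I -> is_ideal (ideal_exp I a).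
Proof.
move=> idI; elim: a => [|a IHa]; first exact: ideal_one_ideal.
exact: ideal_mul_ideal.
Qed.

Lemma ideal_expD I a b x y : is_ideal I ->
  ideal_exp I a x -> ideal_exp I b y -> ideal_exp I (a + b)%N (x * y).
Proof.
move=> idI; elim: a x => [|a IHa] x.
  by move=> _; have [_ _] := ideal_exp_ideal b idI; apply.
case=> r [u [v [Iu Iv ->]]] Iy; exists r, u, (fun k => v k * y); split=> // [k|].
  exact: IHa (Iv k) Iy.
by rewrite mulr_suml; apply: eq_bigr => k _; rewrite mulrA.
Qed.

Lemma ideal_exp_expr I a x : is_ideal I -> I x -> ideal_exp I a (x ^+ a).
Proof.
move=> idI Ix; elim: a => [//|a IHa]; rewrite exprS; exact: ideal_mul_in.
Qed.

Lemma ideal_monomial_ideal m (I : 'I_m -> R -> Prop) a :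
  (forall i, is_ideal (I i)) -> is_ideal (ideal_monomial I a).
Proof.
move=> idI; apply: (big_ind (@is_ideal R)); first exact: ideal_one_ideal.
  exact: ideal_mul_ideal.
by move=> i _; apply: ideal_exp_ideal.
Qed.

Lemma ideal_monomial_prod m (I : 'I_m -> R -> Prop) a (y : 'I_m -> R) :
  (forall i, ideal_exp (I i) (a i) (y i)) -> ideal_monomial I a (\prod_i y i).
Proof.
move=> Iy; apply: (big_ind2 (fun (P : R -> Prop) p => P p)) => //.
by move=> P p Q q; apply: ideal_mul_in.
Qed.

End IdealProducts.

Section ReesMonomials.

Variables (K : fieldType) (n N m : nat).
Local Notation R := {mpoly K[n]}.
Local Notation S := {mpoly K[N]}.

Variables (img : 'I_N -> R) (color : 'I_N -> option 'I_m).
Hypothesis none_var : forall t : 'I_n, exists v, color v = None /\ img v = 'X_t.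
Variable I : 'I_m -> R -> Prop.
Hypothesis idI : forall i, is_ideal (I i).
Hypothesis I_gen : forall i p, I i p <->
  exists c, p = \sum_(v | color v == Some i) c v * img v.
Local Notation rees := (rees img color).

Lemma rees_mul_sub (A B : R -> Prop) a b : (forall p, A p -> rees a p) ->
  (forall p, B p -> rees b p) ->
  forall p, ideal_mul A B p -> rees (fun i => (a i + b i)%N) p.
Proof.
move=> subA subB _ [r [u [v [Au Bv ->]]]].
apply: (big_ind (rees _)) => [|p q|k _]; first exact: rees0.
  exact: reesD.
by apply: reesM; [apply: subA | apply: subB].
Qed.

Lemma rees_exp_sub i k p : ideal_exp (I i) k p ->
  rees (fun j => if j == i then k else 0%N) p.
Proof.
elim: k p => [|k IHk] p.
  move=> _; apply: rees_ext (rees_scalar none_var p) => j.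
  by rewrite if_same.
have subI q : I i q -> rees (fun j => (j == i : nat)) q.
  case/I_gen=> c ->; apply: (big_ind (rees _)) => [|q1 q2|v /eqP cv].
  - exact: rees0.
  - exact: reesD.
  apply: rees_ext (reesM (rees_scalar none_var (c v)) (rees_img _ _ v)) => j.
  by rewrite cv add0n; congr nat_of_bool; apply: eq_sym.
move/(rees_mul_sub subI IHk); apply: rees_ext => j.
by case: eqP.
Qed.

(** A monomial of multidegree a specializes to an element of R times, for each i,
    a product of a_i generators of I_i; such elements span I^a. *)
Lemma rees_monomial a : ideal_monomial I a = rees a.
Proof.
apply: pred_ext => p; split=> [|[s hs <-]].
  pose F i j := if j == i then a i else 0%N.
  pose addf (h h' : 'I_m -> nat) j := (h j + h' j)%N.
  have sub : forall q, ideal_monomial I a q ->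
      rees (\big[addf/fun=> 0%N]_i F i) q.
    apply: (big_ind2 (fun (P : R -> Prop) h => forall q, P q -> rees h q)).
    - by move=> q _; apply: rees_scalar.
    - by move=> P h P' h' hP hP'; apply: rees_mul_sub.
    - by move=> i _ q; apply: rees_exp_sub.
  move/sub; apply: rees_ext => j.
  rewrite (big_morph (fun h : 'I_m -> nat => h j) (op1 := addn) (id1 := 0%N)) //.
  by rewrite (bigD1 j) //= /F eqxx big1 ?addn0 // => i /negPf; rewrite eq_sym => ->.
have [M0 MD MM] := ideal_monomial_ideal a idI.
rewrite [s]mpolyE rmorph_sum big_seq /=.
apply: (big_ind (ideal_monomial I a)) => // mu /hs md_mu.
rewrite (evZ img) -mul_mpolyC; apply: (MM).
rewrite mpolyXE_id rmorph_prod /= (bigID (fun v => color v == None)) /=.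
apply: (MM).
have -> : \prod_(v | color v != None) ev img ('X_v ^+ mu v) =
    \prod_i \prod_(v | color v == Some i) img v ^+ mu v.
  rewrite (exchange_big_dep (fun v => color v != None)) => [|i v _ /eqP->] //=.
  apply: eq_bigr => v; case cv: (color v) => [i|] // _.
  rewrite (eq_bigl (pred1 i)) ?big_pred1_eq ?rmorphXn /= ?evX //.
apply: ideal_monomial_prod => i; rewrite -(md_mu i) /md /multideg.
apply: (big_ind2 (fun k p => ideal_exp (I i) k p)) => //.
  by move=> *; apply: ideal_expD.
move=> v cv; apply: ideal_exp_expr => //; apply/I_gen.
exists (fun w => (w == v)%:R); rewrite (bigD1 v) //= eqxx mul1r big1 ?addr0 //.
by move=> w /andP[_ /negPf->]; rewrite mul0r.
Qed.

End ReesMonomials.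

(** * The Koszul homology of all products at once *)
Section KoszulClosure.

Variables (R : comNzRingType) (x : nat -> R) (n : nat).
Variables (V : lmodType R).

Lemma kcycle_comb (N : V -> Prop) i (z z' : 'I_(krank n i) -> V) c : submodule N ->
  kcycle x N z -> kcycle x N z' -> kcycle x N (fun a => z a + c *: z' a).
Proof.
move=> subN [Nz cz] [Nz' cz']; split=> [a|].
  by apply: (submodD subN) => //; apply: (submodZ subN).
case: i z z' cz cz' {Nz Nz'} => // i z z' cz cz' a.
transitivity (mact (kmx x n i) z a + c *: mact (kmx x n i) z' a); last first.
  by rewrite cz cz' scaler0 addr0.
rewrite scaler_sumr -big_split; apply: eq_bigr => b _ /=.
by rewrite scalerDr !scalerA mulrC.
Qed.

Lemma kboundary_comb (N : V -> Prop) i (z z' : 'I_(krank n i) -> V) c : submodule N ->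
  kboundary x N z -> kboundary x N z' -> kboundary x N (fun a => z a + c *: z' a).
Proof.
move=> subN [w [Nw def_z]] [w' [Nw' def_z']].
exists (fun b => w b + c *: w' b); split=> [b|a].
  by apply: (submodD subN) => //; apply: (submodZ subN).
rewrite -def_z -def_z' scaler_sumr -big_split; apply: eq_bigr => b _ /=.
by rewrite scalerDr !scalerA mulrC.
Qed.

Lemma kcycle_scale (N N' : V -> Prop) i (z : 'I_(krank n i) -> V) c :
  (forall v, N v -> N' (c *: v)) -> kcycle x N z -> kcycle x N' (fun a => c *: z a).
Proof.
move=> NN' [Nz cz]; split=> [a|]; first exact: NN'.
case: i z cz {Nz} => // i z cz a.
transitivity (c *: mact (kmx x n i) z a); last by rewrite cz scaler0.
by rewrite scaler_sumr; apply: eq_bigr => b _; rewrite !scalerA mulrC.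
Qed.

Lemma kboundary_scale (N N' : V -> Prop) i (z : 'I_(krank n i) -> V) c :
  (forall v, N v -> N' (c *: v)) -> kboundary x N z ->
  kboundary x N' (fun a => c *: z a).
Proof.
move=> NN' [w [Nw def_z]]; exists (fun b => c *: w b); split=> [b|a].
  exact: NN'.
rewrite -def_z scaler_sumr; apply: eq_bigr => b _.
by rewrite !scalerA mulrC.
Qed.

Lemma kboundary_kcycle (N : V -> Prop) i (z : 'I_(krank n i) -> V) :
  submodule N -> kboundary x N z -> kcycle x N z.
Proof.
move=> subN [w [Nw def_z]]; split=> [a|].
  by rewrite -def_z; apply: mact_submod.
case: i z w Nw def_z => // i z w Nw def_z a.
by rewrite -(mact_ext _ def_z) -mactM kmx_sq mact0l.
Qed.

End KoszulClosure.

Section ReesHomology.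

Variables (K : fieldType) (n N m : nat).
Local Notation R := {mpoly K[n]}.
Local Notation S := {mpoly K[N]}.
Local Notation x := (xvar K n).

Variables (img : 'I_N -> R) (delta : 'I_N -> nat) (color : 'I_N -> option 'I_m).
Hypothesis img_homog : forall v, img v \is (delta v).-homog.
Hypothesis img_none : forall v, color v = None ->
  exists t : 'I_n, img v = 'X_t.
Hypothesis none_var : forall t : 'I_n, exists v, color v = None /\ img v = 'X_t.
Local Notation rees := (rees img color).
Local Notation ev := (ev img).
Local Notation wt := (wt delta).
Local Notation md := (md color).

Variable j : nat.
Local Notation p := (krank n j).

(** Vectors over S of multidegree a and weight e, lifting the Koszul chains with
    entries of degree e in [rees a]. *)
Definition bihom a e (u : 'rV[S]_p) := forall k mu, mu \in msupp (u 0 k) ->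
  md mu =1 a /\ wt mu = e.

Definition ev_chain (u : 'rV[S]_p) : 'I_p -> R^o := fun k => ev (u 0 k).

Definition lifted_cycle a e u := bihom a e u /\ kcycle (V := R^o) x (rees a) (ev_chain u).
Definition lifted_boundary a e u := bihom a e u /\ kboundary (V := R^o) x (rees a) (ev_chain u).

Let reesZ := rees_submodule none_var.

Lemma bihom_comb a e u v (c : K) :
  bihom a e u -> bihom a e v -> bihom a e (u + c%:MP *: v).
Proof.
move=> hu hv k mu; rewrite !mxE mul_mpolyC => /msuppD_le; rewrite mem_cat.
by case/orP=> [/hu|/msuppZ_le/hv].
Qed.

Lemma bihom_mulX a e u kap : bihom a e u ->
  bihom (fun i => (md kap i + a i)%N) (wt kap + e)%N ('X_[kap] *: u).
Proof.
move=> hu k mu; rewrite !mxE => /msuppM_le/allpairsP[[m1 m2] /= []].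
rewrite msuppX inE => /eqP-> /hu[md2 wt2] ->; split=> [i|].
  by rewrite mdD md2.
by rewrite wtD wt2.
Qed.

Lemma ev_chain_comb u v (c : K) :
  ev_chain (u + c%:MP *: v) =1 fun k => ev_chain u k + c%:MP *: ev_chain v k.
Proof. by move=> k; rewrite /ev_chain !mxE rmorphD rmorphM /= evC. Qed.

Lemma ev_chain_mulX kap u :
  ev_chain ('X_[kap] *: u) =1 fun k => ev 'X_[kap] *: ev_chain u k.
Proof. by move=> k; rewrite /ev_chain !mxE rmorphM. Qed.

Lemma ev_chain0 : ev_chain 0 =1 fun=> 0.
Proof. by move=> k; rewrite /ev_chain mxE rmorph0. Qed.

Lemma lifted_cycle_subspace a e : subspace (lifted_cycle a e).
Proof.
split=> [|u v c [hu cu] [hv cv]].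
  split=> [k mu|]; first by rewrite mxE msupp0.
  apply: kboundary_kcycle => //; exists (fun=> 0); split=> [b|k].
    exact: rees0.
  by rewrite ev_chain0 mact0.
split; first exact: bihom_comb.
rewrite (functional_extensionality _ _ (ev_chain_comb u v c)).
exact: kcycle_comb.
Qed.

Lemma lifted_boundary_subspace a e : subspace (lifted_boundary a e).
Proof.
split=> [|u v c [hu cu] [hv cv]].
  split=> [k mu|]; first by rewrite mxE msupp0.
  exists (fun=> 0); split=> [b|k]; first exact: rees0.
  by rewrite ev_chain0 mact0.
split; first exact: bihom_comb.
rewrite (functional_extensionality _ _ (ev_chain_comb u v c)).
exact: kboundary_comb.
Qed.

(** Multidegree and weight of a bihomogeneous vector are those of its leading
    monomial, so one predicate on exponents records the leading terms in all
    degrees. *)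
Definition lead_of (U : ('I_m -> nat) -> nat -> 'rV[S]_p -> Prop) c
    (f : 'I_N -> nat) :=
  exists2 u, U (md (mnm_of f)) (wt (mnm_of f)) u & has_lead u c (mnm_of f).

Lemma rees_mulX kap a (q : R^o) :
  rees a q -> rees (fun i => (md kap i + a i)%N) (ev 'X_[kap] *: q).
Proof.
apply: reesM; exists 'X_[kap] => // mu.
by rewrite msuppX inE => /eqP->.
Qed.

Lemma md_eqD f f' kap : mnm_of f' = (kap + mnm_of f)%MM ->
  md (mnm_of f') = fun i => (md kap i + md (mnm_of f) i)%N.
Proof. by move=> ->; apply: functional_extensionality => i; rewrite mdD. Qed.

Lemma lead_of_upclosed U c :
  (forall a e u kap, U a e u ->
     U (fun i => (md kap i + a i)%N) (wt kap + e)%N ('X_[kap] *: u)) ->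
  upclosed (lead_of U c).
Proof.
move=> UX f f' /mnm_of_le[kap def_f'] [u Uu lead_u].
exists ('X_[kap] *: u); last by rewrite def_f'; apply: has_lead_mulX.
by rewrite (md_eqD def_f') def_f' wtD; apply: UX.
Qed.

Lemma lifted_cycle_mulX a e u kap : lifted_cycle a e u ->
  lifted_cycle (fun i => (md kap i + a i)%N) (wt kap + e)%N ('X_[kap] *: u).
Proof.
case=> hu cu; split; first exact: bihom_mulX.
rewrite (functional_extensionality _ _ (ev_chain_mulX kap u)).
by apply: kcycle_scale cu => q; apply: rees_mulX.
Qed.

Lemma lifted_boundary_mulX a e u kap : lifted_boundary a e u ->
  lifted_boundary (fun i => (md kap i + a i)%N) (wt kap + e)%N ('X_[kap] *: u).
Proof.
case=> hu cu; split; first exact: bihom_mulX.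
rewrite (functional_extensionality _ _ (ev_chain_mulX kap u)).
by apply: kboundary_scale cu => q; apply: rees_mulX.
Qed.

(** Multiplication by a variable of R kills Koszul homology. *)
Lemma lead_of_kill c v f : color v = None -> lead_of lifted_cycle c f ->
  lead_of lifted_boundary c (fun w => f w + (w == v))%N.
Proof.
move=> cv [u [hu cu] lead_u]; set f' := fun w => _.
have def_f' : mnm_of f' = (U_(v) + mnm_of f)%MM.
  by apply/mnmP=> w; rewrite mnmDE !mnmE eq_sym addnC.
exists ('X_v *: u); last by rewrite def_f'; apply: has_lead_mulX.
split; first by rewrite (md_eqD def_f') def_f' wtD; apply: bihom_mulX.
have -> : md (mnm_of f') = md (mnm_of f).
  by rewrite (md_eqD def_f'); apply: functional_extensionality => i; rewrite md1 cv.
rewrite (functional_extensionality _ _ (ev_chain_mulX U_(v) u)) evX.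
have [t ->] := img_none cv; rewrite -xvarE.
exact: kcycle_kill.
Qed.

(** The homology is not zero in degree (a, e) when the lifted cycles and the
    lifted boundaries of that degree differ, and by [lead_reduction] they agree
    when they have the same leading terms. *)
Lemma rees_homology a e : ideal_homology_neq0 (rees a) j e <->
  exists c f, [/\ lead_of lifted_cycle c f, ~ lead_of lifted_boundary c f,
    multideg color f =1 a & weight delta f = e].
Proof.
have mdE f : md (mnm_of f) = multideg color f.
  by apply: functional_extensionality => i; apply: eq_bigr => v _; rewrite mnmE.
have wtE f : wt (mnm_of f) = weight delta f.
  by apply: eq_bigr => v _; rewrite mnmE.
split=> [[z [cz hz nbz]]|[c [f [[u [hu cu] lead_u] nV mdf wtf]]]].
  have [Jz _] := cz.
  have /fin_all_exists[s hs] k : exists s, (of_multideg color a s /\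
      (forall mu, mu \in msupp s -> wt mu = e)) /\ ev s = z k.
    have [s hs def_s] := rees_component img_homog e (Jz k).
    by exists s; split=> //; rewrite def_s pihomog_dE //; apply: hz.
  (* a bihomogeneous lift of the cycle, entry by entry *)
  pose u : 'rV_p := \row_k s k.
  have def_z : ev_chain u = z.
    apply: functional_extensionality => k; rewrite /ev_chain mxE.
    by have [_ ->] := hs k.
  apply: NNPP => none; apply: nbz; rewrite -def_z.
  suff [] : lifted_boundary a e u by [].
  apply: (lead_reduction (lifted_cycle_subspace a e) (lifted_boundary_subspace a e)).
  - by move=> v [hv bv]; split=> //; apply: kboundary_kcycle.
  - move=> v c mu [hv cv] lead_v.
    have [mdmu wtmu] : md mu =1 a /\ wt mu = e.
      by case: (lead_v) => _ vc def_mu; apply: (hv c); rewrite -def_mu mlead_supp.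
    have {}mdmu : md mu = a by apply: functional_extensionality.
    have [[w Vw lead_w]|nV] := classic (lead_of lifted_boundary c (fun i => mu i)).
      by rewrite mnm_ofK mdmu wtmu in Vw lead_w; exists w.
    case: none; exists c, (fun i => mu i); split=> //.
    + by exists v; rewrite mnm_ofK // mdmu wtmu.
    + by rewrite -mdE mnm_ofK mdmu.
  - split; last by rewrite def_z.
    move=> k mu; rewrite mxE => mu_s; have [[h1 h2] _] := hs k.
    by split; [apply: h1 | apply: h2].
have {}mdf : md (mnm_of f) = a by rewrite mdE; apply: functional_extensionality.
have {}wtf : wt (mnm_of f) = e by rewrite wtE.
exists (ev_chain u); split.
- by rewrite -mdf.
- by move=> k; apply: (ev_homog img_homog) => mu /hu[_ ->].
move=> bu; apply: nV; exists u => //; split=> //.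
by rewrite mdf.
Qed.

Lemma rees_homology_max :
  exists b (lam : 'I_b -> 'I_m -> nat) (lam0 : 'I_b -> int),
    (forall k i, exists v, color v = Some i /\ lam k i = delta v) /\
    eventually (fun a =>
      (forall e, ideal_homology_neq0 (rees a) j e ->
         exists k, ((e + j)%N%:Z <= linear_fun (lam k) (lam0 k) a)%R) /\
      (forall k, exists2 e, ideal_homology_neq0 (rees a) j e &
         (e + j)%N%:Z = linear_fun (lam k) (lam0 k) a)).
Proof.
have [b [lam [lam0 [lam_delta [bnd maxL]]]]] := max_weight_linear
  delta (fun c => lead_of_upclosed (c := c) lifted_cycle_mulX)
  (fun c => lead_of_upclosed (c := c) lifted_boundary_mulX) lead_of_kill.
have shift k a : linear_fun (lam k) (lam0 k + j%:Z) a =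
    linear_fun (lam k) (lam0 k) a + j%:Z.
  by rewrite /linear_fun addrA.
exists b, lam, (fun k => lam0 k + j%:Z); split=> //.
exists bnd => a /maxL[upL atL]; split=> [e|k].
  case/rees_homology=> c [f [Uf nVf mdf <-]].
  have [//|k le_k] := upL c f _ mdf.
  by exists k; rewrite shift PoszD lerD2r.
have [c [f [[Uf nVf] mdf def_L]]] := atL k.
exists (weight delta f); first by apply/rees_homology; exists c, f.
by rewrite shift PoszD def_L.
Qed.

End ReesHomology.

(** * The theorem *)
Lemma bigmax_EFin_shift b (L : 'I_b -> int) c :
  \big[Order.max/@ENInf int]_(k < b) EFin (L k + c) =
  \big[Order.max/@ENInf int]_(k < b) EFin (L k) + EFin c.
Proof.
rewrite (big_morph (fun y : extended int => y + EFin c)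
  (op1 := Order.max) (id1 := @ENInf int)) //.
by move=> y z; rewrite adde_maxl.
Qed.

Lemma eventually_all m (T : finType) (P : T -> ('I_m -> nat) -> Prop) :
  (forall t, eventually (P t)) -> eventually (fun a => forall t, P t a).
Proof.
move=> /fin_all_exists[bnd hP]; exists (fun i => \max_t bnd t i)%N => a le_a t.
by apply: hP => i; apply: leq_trans (le_a i); apply: (leq_bigmax (F := fun t => bnd t i)).
Qed.

(** The variables of S: those of R, and one for each generator of each ideal. *)
Section ReesVariables.

Variables (K : fieldType) (n m : nat).
Local Notation R := {mpoly K[n]}.
Variables (g : 'I_m -> nat) (f : forall i, 'I_(g i) -> R) (d : forall i, 'I_(g i) -> nat).

Let V : finType := ('I_n + {i : 'I_m & 'I_(g i)})%type.

Definition gen_img (v : 'I_#|V|) : R :=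
  match enum_val v with inl t => 'X_t | inr u => f (tagged u) end.
Definition gen_delta (v : 'I_#|V|) : nat :=
  match enum_val v with inl _ => 1%N | inr u => d (tagged u) end.
Definition gen_color (v : 'I_#|V|) : option 'I_m :=
  match enum_val v with inl _ => None | inr u => Some (tag u) end.

Lemma gen_color_none v : gen_color v = None ->
  gen_delta v = 1%N /\ exists t : 'I_n, gen_img v = 'X_t.
Proof.
by rewrite /gen_color /gen_delta /gen_img; case: enum_val => // t _; split=> //; exists t.
Qed.

Lemma gen_none_var (t : 'I_n) : exists v, gen_color v = None /\ gen_img v = 'X_t.
Proof. by exists (enum_rank (inl t : V)); rewrite /gen_color /gen_img enum_rankK. Qed.

Lemma gen_color_some v i : gen_color v = Some i ->
  exists l : 'I_(g i), gen_img v = f l /\ gen_delta v = d l.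
Proof.
rewrite /gen_color /gen_delta /gen_img.
by case: enum_val => // -[i' l] [<-]; exists l.
Qed.

Lemma gen_span (I : 'I_m -> R -> Prop) :
  (forall i, homogeneous_ideal (I i)) ->
  (forall i, @minimal_hom_gens _ R^o (@poly_hom K n) (I i) _ (@d i) (@f i)) ->
  forall i p, I i p <->
    exists c, p = \sum_(v | gen_color v == Some i) c v * gen_img v.
Proof.
move=> homI gens i p; have [[I0 ID IM] _] := homI i; have [gen _ _] := gens i.
have If (l : 'I_(g i)) : I i (f l).
  apply/gen; exists (fun k => (k == l)%:R); rewrite (bigD1 l) //= eqxx scale1r.
  by rewrite big1 ?addr0 // => k /negPf->; rewrite scale0r.
split=> [/gen[c ->]|[c ->]].
  apply: (big_ind (fun p => exists c, p = \sum_(v | gen_color v == Some i) c v * gen_img v)).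
  - by exists (fun=> 0); rewrite big1 // => v _; rewrite mul0r.
  - move=> _ _ [c1 ->] [c2 ->]; exists (fun v => c1 v + c2 v).
    by rewrite -big_split; apply: eq_bigr => v _; rewrite mulrDl.
  move=> l _; pose w := enum_rank (inr (Tagged (fun i => 'I_(g i)) l) : V).
  exists (fun v => if v == w then c l else 0).
  rewrite (bigD1 w) /=; last by rewrite /gen_color enum_rankK.
  rewrite eqxx big1 ?addr0 => [|v /andP[_ /negPf->]]; last by rewrite mul0r.
  by rewrite /gen_img enum_rankK.
apply: (big_ind (I i)) => // v /eqP/gen_color_some[l [-> _]].
exact: IM.
Qed.

End ReesVariables.

Theorem theorem2p2 (K : fieldType) (n : nat) (n_gt0 : (0 < n)%N) (m : nat)
    (I : 'I_m -> {mpoly K[n]} -> Prop)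
    (I_hom : forall i, homogeneous_ideal (I i))
    (I_neq0 : forall i, exists2 p, I i p & p != 0)
    (g : 'I_m -> nat)
    (f : forall i, 'I_(g i) -> {mpoly K[n]})
    (d : forall i, 'I_(g i) -> nat)
    (f_gens : forall i,
       @minimal_hom_gens _ {mpoly K[n]}^o (@poly_hom K n) (I i) _ (d i) (f i)) :
  exists (b : 'I_n -> nat)
         (lam : forall j : 'I_n, 'I_(b j) -> 'I_m -> nat)
         (lam0 : forall j : 'I_n, 'I_(b j) -> int),
    [/\ forall (j : 'I_n) (k : 'I_(b j)) (i : 'I_m),
          exists l : 'I_(g i), lam j k i = d i l,
        forall j : 'I_n, eventually (fun a =>
          tdeg j (ideal_monomial I a) =
          \big[Order.max/@ENInf int]_(k < b j)
            EFin (linear_fun (lam j k) (lam0 j k) a)),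
        exists p : nat, eventually (fun a =>
          @is_pd _ {mpoly K[n]}^o (ideal_monomial I a) p)
      & eventually (fun a =>
          is_regularity (ideal_monomial I a)
            (\big[Order.max/@ENInf int]_(j < n)
             \big[Order.max/@ENInf int]_(k < b j)
               EFin (linear_fun (lam j k) (lam0 j k) a - j%:Z)))].
Proof.
pose img := gen_img f; pose delta := gen_delta (n := n) d; pose color := gen_color (n := n) (g := g).
have img_homog v : img v \is (delta v).-homog.
  case cv: (color v) => [i|].
    have [l [def_img def_delta]] := gen_color_some f d cv.
    rewrite /img /delta def_img def_delta.
    by have [_ _ hom] := f_gens i; apply: hom.
  have [def_delta [t def_img]] := gen_color_none f d cv.
  by rewrite /img /delta def_delta def_img -xvarE; apply: xvar_homog.
have none_var : forall t : 'I_n, exists v, color v = None /\ img v = 'X_t.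
  exact: gen_none_var.
have img_none v : color v = None -> exists t : 'I_n, img v = 'X_t.
  by case/(gen_color_none f d).
have monE a : ideal_monomial I a = rees img color a.
  apply: rees_monomial => //; first by move=> i; have [] := I_hom i.
  exact: gen_span.
have hom_mon a : homogeneous_ideal (ideal_monomial I a).
  by rewrite monE; apply: (rees_homogeneous img_homog).
have /fin_all_exists[b /fin_all_exists[lam /fin_all_exists[lam0 hL]]] (j : 'I_n) :=
  rees_homology_max img_homog img_none none_var j.
have evL : eventually (fun a => forall j : 'I_n,
    (forall e, ideal_homology_neq0 (ideal_monomial I a) j e ->
       exists k, ((e + j)%N%:Z <= linear_fun (lam j k) (lam0 j k) a)%R) /\
    (forall k, exists2 e, ideal_homology_neq0 (ideal_monomial I a) j e &
       (e + j)%N%:Z = linear_fun (lam j k) (lam0 j k) a)).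
  apply: eventually_all => j; have [_ [bnd evj]] := hL j.
  by exists bnd => a /evj; rewrite monE.
have [bnd {}evL] := evL.
have top a j e : (n <= j)%N -> ~ ideal_homology_neq0 (ideal_monomial I a) j e.
  by apply: ideal_homology_top => //; rewrite monE; apply: rees_submodule.
have tdegE a : (forall i, (bnd i <= a i)%N) -> forall j : 'I_n,
    tdeg j (ideal_monomial I a) =
      \big[Order.max/@ENInf int]_(k < b j) EFin (linear_fun (lam j k) (lam0 j k) a).
  by move=> /evL la j; have [upL atL] := la j; apply: tdeg_eq_max.
exists b, lam, lam0; split.
- move=> j k i; have [/(_ k i)[v [cv ->]] _] := hL j.
  by have [l [_ def_l]] := gen_color_some f d cv; exists l.
- by move=> j; exists bnd => a /tdegE.
- pose p := (\max_(j < n | 0 < b j) j)%N; exists p, bnd => a /evL la.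
  apply: ideal_is_pd => // [j e ltpj nz|].
    have [le_nj|ltjn] := leqP n j; first exact: top nz.
    have [upL _] := la (Ordinal ltjn); have [k _] := upL e nz.
    have : (j <= p)%N.
      apply: (@leq_bigmax_cond _ _ (fun j : 'I_n => j : nat) (Ordinal ltjn)).
      exact: leq_ltn_trans (ltn_ord k).
    by rewrite leqNgt ltpj.
  have [b0|] := posnP #|[pred j : 'I_n | 0 < b j]%N|.
    left; rewrite /p big_pred0 // => j.
    by have := card0_eq b0 j.
  case/(eq_bigmax_cond (fun j : 'I_n => j : nat)) => j; rewrite inE => bj_gt0 def_p.
  right; have -> : p = j by rewrite -def_p; apply: eq_bigl.
  have [_ atL] := la j; have [e nz _] := atL (Ordinal bj_gt0).
  by exists e.
exists bnd => a la; have {}tdegE := tdegE a la.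
under eq_bigr => j _ do rewrite bigmax_EFin_shift -tdegE.
split=> [|j].
  have [//|j _|j _ ->] := @Order.TotalTheory.eq_bigmax _ _ 'I_n (@ENInf int)
    (Ordinal n_gt0) xpredT (fun j : 'I_n => tdeg j (ideal_monomial I a) + EFin (- j%:Z)).
    by rewrite leNye.
  by exists j.
have [le_nj|ltjn] := leqP n j; last first.
  exact: (le_bigmax _ (fun j : 'I_n => tdeg j (ideal_monomial I a) + EFin (- j%:Z))
    (Ordinal ltjn)).
rewrite (@tdeg_eq_max _ _ _ _ 0%N (fun=> 0)) //.
- by rewrite big_ord0 leNye.
- by move=> e /(top _ _ _ le_nj).
by case.
Qed.
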